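(* Let $p_1,p_2,q\in(0,1)$ be distinct. Then for any $t>0$, in the model $\mathrm{CSBM}(p_1,p_2,q,\alpha)$ with $\alpha=t\log n/n$, the two-step estimator $\hat X(\hat\sigma_{\mathrm{Deg}})$ built from the degree-based estimator $\hat\sigma_{\mathrm{Deg}}$ and the genie-aided estimator $\hat\sigma_{\mathrm{Best}}$ satisfy, as $n\to\infty$, $$\mathrm{Err}\big(\hat X(\hat\sigma_{\mathrm{Deg}})\big)=(1+o(1))\,\mathrm{Err}(\hat\sigma_{\mathrm{Best}})+o(1/n).$$ Furthermore, if $t>t_c(p_1,p_2,q)$, where $$t_c(p_1,p_2,q)=\Big[1-\tfrac12\min_{x\in[0,1]}\sum_{i=1}^4 (c_1)_i^{x}(c_2)_i^{1-x}\Big]^{-1},\quad c_1=(p_1,1-p_1,q,1-q),\ \ c_2=(q,1-q,p_2,1-p_2),$$ then $\hat X(\hat\sigma_{\mathrm{Deg}})$ achieves exact recovery.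
   Context: Censored stochastic block model $\mathrm{CSBM}(p_1,p_2,q,\alpha)$ on vertex set $[n]$: the labels $\sigma_0(i)\in\{\pm1\}$, $i\in[n]$, are i.i.d. uniform. Given $\sigma_0$, independently over unordered pairs $i\ne j$, there is an edge between $i$ and $j$ with probability $p_1$ if $\sigma_0(i)=\sigma_0(j)=+1$, $p_2$ if $\sigma_0(i)=\sigma_0(j)=-1$, and $q$ if $\sigma_0(i)\neq\sigma_0(j)$ (no self-loops). Independently over pairs, the status of each pair is revealed with probability $\alpha=t\log n/n$, where $t>0$ is a constant. The observation $G$ assigns to each pair a status in {present, absent, censored}: ''present'' if revealed and an edge, ''absent'' if revealed and a non-edge, ''censored'' if not revealed. Degree-based estimator: with $\deg(i)$ the number of present edges incident to $i$, $$\hat\sigma_{\mathrm{Deg}}(i)=\mathrm{sign}\Big(\deg(i)-\tfrac{t\log n}{4}(p_1+p_2+2q)\Big).$$ Two-step estimator: for $\sigma\in\{\pm1\}^n$ and $u\in[n]$ let $D_1(\sigma,u),D_2(\sigma,u)$ be the numbers of present, respectively absent, pairs $\{u,v\}$ with $v\ne u$, $\sigma(v)=+1$, and $D_3(\sigma,u),D_4(\sigma,u)$ the numbers of present, respectively absent, pairs $\{u,v\}$ with $v\neq u$, $\sigma(v)=-1$. Let $$\Gamma(u,\sigma,p_1,p_2,q)=D_1\log\tfrac{p_1}{q}+D_2\log\tfrac{1-p_1}{1-q}+D_3\log\tfrac{q}{p_2}+D_4\log\tfrac{1-q}{1-p_2},\qquad D_k=D_k(\sigma,u).$$ Given an initial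 estimator $\hat\sigma$, $\hat X(\hat\sigma)\in\{\pm1\}^n$ has entries $\hat X(\hat\sigma,u)=+1$ if $\Gamma(u,\hat\sigma,p_1,p_2,q)\ge0$ and $-1$ otherwise. Genie-aided estimator: $\hat\sigma_{\mathrm{Best}}(u)=\arg\max_{r\in\{\pm1\}}\mathbb{P}\big(\sigma_0(u)=r\mid G,(\sigma_0(v))_{v\in[n]\setminus\{u\}}\big)$ for each $u$, ties broken in favour of $+1$. Error rate: $\mathrm{Err}(\hat\sigma)=\mathbb{E}\Big[\min_{s\in\{-1,+1\}}\frac1n\sum_{i=1}^n\mathbf 1\{\hat\sigma(i)\neq s\,\sigma_0(i)\}\Big]$. An estimator $\hat\sigma$ achieves exact recovery if $\lim_{n\to\infty}\mathbb{P}(\exists s\in\{\pm1\}:\hat\sigma=s\sigma_0)=1$. $\log$ is the natural logarithm.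
   Formalization: When p1 < p2 the degree-based estimator is negated before being fed to the two-step estimator (it is unchanged when p1 > p2); without this sign correction it estimates −σ0 and the claim fails, e.g. for p1=.1, p2=.9, q=.5, t=12. *)

(* Defs.v *)
From HB Require Import structures.
From mathcomp Require Import all_boot all_order all_algebra.
From mathcomp Require Import all_classical all_reals all_analysis.

Set Implicit Arguments.
Unset Strict Implicit.
Unset Printing Implicit Defensive.

Import Order.TTheory GRing.Theory Num.Theory.
Import numFieldNormedType.Exports.

Local Open Scope ring_scope.

(* The signs {+1, -1} are encoded as booleans: true is +1 and false is -1. *)
Definition labels (n : nat) : finType := {ffun 'I_n -> bool}.

Definition signed n (s : bool) (sigma : labels n) : labels n :=
  [ffun i => if s then sigma i else ~~ sigma i].

Definition upair (n : nat) : finType := {e : {set 'I_n} | #|e| == 2}.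

Definition status : finType := option bool.
Definition present : status := Some true.
Definition absent : status := Some false.
Definition censored : status := None.

Definition observation (n : nat) : finType := {ffun upair n -> status}.

(* When u = v the set {u, v} is not a pair and the value is [censored], so a
   vertex is never incident to itself. *)
Definition pair_status n (G : observation n) (u v : 'I_n) : status :=
  if insub [set u; v]%SET is Some e then G e else censored.

(* A sample point consists of the labels, the underlying graph (its set of
   edges) and the set of revealed pairs. *)
Definition sample (n : nat) : finType :=
  (labels n * {ffun upair n -> bool} * {ffun upair n -> bool})%type.

Definition sigma0 n (w : sample n) : labels n := w.1.1.

Definition obs n (w : sample n) : observation n :=
  [ffun e => if w.2 e then Some (w.1.2 e) else censored].

Section Model.
Variables (R : realType) (p1 p2 q t : R) (n : nat).

(* The value lies in [0, 1], and [mass] is a probability mass function, as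
   soon as n is large enough; only such n matter for the asymptotics. *)
Definition alpha : R := t * ln n%:R / n%:R.

Definition edge_prob (sigma : labels n) (e : upair n) : R :=
  if [forall v in val e, sigma v] then p1
  else if [forall v in val e, ~~ sigma v] then p2
  else q.

Definition bern (a : R) (b : bool) : R := if b then a else 1 - a.

Definition mass (w : sample n) : R :=
  2^-1 ^+ n * \prod_(e : upair n)
    (bern (edge_prob (sigma0 w) e) (w.1.2 e) * bern alpha (w.2 e)).

Definition Pr (E : pred (sample n)) : R := \sum_(w | E w) mass w.

Definition cond_Pr (E F : pred (sample n)) : R := Pr (predI E F) / Pr F.

Definition Ex (X : sample n -> R) : R := \sum_w mass w * X w.

Definition deg (G : observation n) (i : 'I_n) : nat :=
  #|[pred v | pair_status G i v == present]|.

(* The convention is sign(0) = +1. *)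
Definition sigma_deg (G : observation n) : labels n :=
  [ffun i => 0 <= (deg G i)%:R - t * ln n%:R / 4 * (p1 + p2 + 2 * q)].

(* Community +1 has the larger expected degrees exactly when p2 < p1, so
   [sigma_deg] estimates sigma0 when p2 < p1 and - sigma0 when p1 < p2. Since
   [Gamma] refers to the actual names of the communities, the estimator passed
   to it is [sigma_deg] with the global sign dictated by p1 and p2 (hence
   [sigma_deg] itself when p2 < p1). *)
Definition oriented (sigma : labels n) : labels n := signed (p2 < p1) sigma.

Definition Dcount (G : observation n) (sigma : labels n) (u : 'I_n)
    (s : bool) (st : status) : nat :=
  #|[pred v | [&& v != u, sigma v == s & pair_status G u v == st]]|.

Definition Gamma (G : observation n) (u : 'I_n) (sigma : labels n) : R :=
  let D1 := (Dcount G sigma u true present)%:R in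
  let D2 := (Dcount G sigma u true absent)%:R in
  let D3 := (Dcount G sigma u false present)%:R in
  let D4 := (Dcount G sigma u false absent)%:R in
  D1 * ln (p1 / q) + D2 * ln ((1 - p1) / (1 - q))
  + D3 * ln (q / p2) + D4 * ln ((1 - q) / (1 - p2)).

Definition two_step (G : observation n) (sigma : labels n) : labels n :=
  [ffun u => 0 <= Gamma G u sigma].

(* The posterior probability of the event {sigma0(u) = r}, given the values
   taken at w by the observation and by the labels other than that of u. *)
Definition posterior (w : sample n) (u : 'I_n) (r : bool) : R :=
  cond_Pr [pred w' | sigma0 w' u == r]
          [pred w' | (obs w' == obs w) &&
             [forall v, (v != u) ==> (sigma0 w' v == sigma0 w v)]].

Definition sigma_best (w : sample n) : labels n :=
  [ffun u => posterior w u false <= posterior w u true].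

Definition mismatch (s : bool) (hat sigma : labels n) : R :=
  n%:R^-1 * \sum_(i < n) (hat i != signed s sigma i)%:R.

Definition Err (hat : sample n -> labels n) : R :=
  Ex (fun w => Num.min (mismatch true (hat w) (sigma0 w))
                       (mismatch false (hat w) (sigma0 w))).

Definition recovery_Pr (hat : sample n -> labels n) : R :=
  Pr [pred w | [exists s : bool, hat w == signed s (sigma0 w)]].

End Model.

Definition exact_recovery (R : realType) (p1 p2 q t : R)
    (hat : forall n, sample n -> labels n) : Prop :=
  ((fun n => recovery_Pr p1 p2 q t (hat n)) @ \oo --> (1 : R))%classic.

Section Threshold.
Variables (R : realType) (p1 p2 q : R).

Definition c1 : 4.-tuple R := [tuple p1; 1 - p1; q; 1 - q].
Definition c2 : 4.-tuple R := [tuple q; 1 - q; p2; 1 - p2].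

Definition chernoff (x : R) : R :=
  \sum_(i < 4) tnth c1 i `^ x * tnth c2 i `^ (1 - x).

(* By continuity the infimum is attained, i.e. it is the minimum. *)
Definition t_c : R :=
  (1 - 2^-1 * inf [set chernoff x | x in `[0, 1]]%classic)^-1.

End Threshold.

(* Main.v *)
Require Import Defs.
From mathcomp Require Import all_boot all_order all_algebra.
From mathcomp Require Import all_classical all_reals all_analysis.
From mathcomp Require Import ring lra.

Set Implicit Arguments.
Unset Strict Implicit.
Unset Printing Implicit Defensive.

Import Order.TTheory GRing.Theory Num.Theory.
Import numFieldNormedType.Exports.
Local Open Scope classical_set_scope.
Local Open Scope ring_scope.

(* A genie who knows all the labels but that of u decides by the sign of the
   log-likelihood ratio Gamma(u, sigma0). Each vertex is misclassified by the
   degree estimator with probability n^(-c), and u has O(log n) revealed pairs,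
   so up to probability o(1/n) at most a constant number K of the revealed
   neighbours of u are misclassified. Hence the two-step estimator differs from
   the genie at u only if some revealed neighbour of u is misclassified and
   |Gamma(u, sigma0)| = O(K). These two events are almost independent, since
   the first one can be controlled through the pairs avoiding u. As Gamma is a
   log-likelihood ratio, exchanging the two values of sigma0(u) shows that
   P(|Gamma| <= x) <= (1 + e^x) P(the genie errs at u): the two estimators
   disagree at u with probability o(P(the genie errs at u)) + o(1/n).
   The minimum over the global sign is harmless, because x |-> min(x, 1 - x) is
   1-Lipschitz, and because the errors of the genie at two vertices are almost
   independent, so that the genie errs at more than half of the vertices only
   negligibly often. A Chernoff bound for P(the genie errs at u) then gives exact
   recovery above the threshold. *)

(** * Expectations under product weights *)

Section ProductExpectation.
Variables (R : numDomainType) (E S : finType) (h : E -> S -> R).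

Definition pE (f : {ffun E -> S} -> R) : R :=
  \sum_(G : {ffun E -> S}) (\prod_e h e (G e)) * f G.

Definition upd (G : {ffun E -> S}) (e : E) (s : S) : {ffun E -> S} :=
  [ffun e' => if e' == e then s else G e'].

Definition indep (e : E) (f : {ffun E -> S} -> R) : Prop :=
  forall G s, f (upd G e s) = f G.

Hypothesis h1 : forall e, \sum_s h e s = 1.

Lemma eq_pE f g : f =1 g -> pE f = pE g.
Proof. by move=> fg; apply: eq_bigr => G _; rewrite fg. Qed.

Lemma pE1 : pE (fun=> 1) = 1.
Proof.
rewrite /pE; under eq_bigr do rewrite mulr1.
by rewrite -(bigA_distr_bigA (fun e s => h e s)) big1.
Qed.

Lemma pE_sum (I : finType) (P : pred I) (f : I -> {ffun E -> S} -> R) :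
  pE (fun G => \sum_(i | P i) f i G) = \sum_(i | P i) pE (f i).
Proof.
by rewrite /pE exchange_big /=; apply: eq_bigr => G _; rewrite mulr_sumr.
Qed.

Lemma pED f g : pE (fun G => f G + g G) = pE f + pE g.
Proof. by rewrite /pE -big_split; apply: eq_bigr => G _; rewrite mulrDr. Qed.

Lemma pEZ c f : pE (fun G => c * f G) = c * pE f.
Proof. by rewrite /pE mulr_sumr; apply: eq_bigr => G _; rewrite mulrCA. Qed.

Lemma pE_indep e f g : indep e f ->
  pE (fun G => f G * g (G e)) = pE f * \sum_s h e s * g s.
Proof.
move=> fe.
(* Swapping the value of G at e with an independent copy of it preserves the
   weights and f. *)
pose w (x : {ffun E -> S} * S) :=
  (\prod_e' h e' (x.1 e')) * h e x.2 * f x.1.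
pose swap (x : {ffun E -> S} * S) := (upd x.1 e x.2, x.1 e).
have swapK : involutive swap.
  case=> G s; congr (_, _); last by rewrite /= ffunE eqxx.
  by apply/ffunP => e'; rewrite !ffunE; case: eqP => // ->.
have w_swap x : w (swap x) = w x.
  case: x => G s; rewrite /w /= fe; congr (_ * _).
  rewrite (bigD1 e) //= [in RHS](bigD1 e) //= !ffunE eqxx.
  rewrite (eq_bigr (fun e' => h e' (G e'))); first by ring.
  by move=> e' /negbTE ne; rewrite ffunE ne.
transitivity (\sum_x w x * g (x.1 e)).
  rewrite -(pair_bigA _ (fun G s => w (G, s) * g (G e))) /=.
  apply: eq_bigr => G _; rewrite mulrA -mulr_suml; congr (_ * _).
  by rewrite /w /= -mulr_suml -mulr_sumr h1 mulr1.
rewrite (reindex_inj (inv_inj swapK)) /=.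
under eq_bigr do rewrite w_swap ffunE eqxx.
rewrite -(pair_bigA _ (fun G s => w (G, s) * g s)) /= /pE mulr_suml.
apply: eq_bigr => G _; rewrite mulr_sumr; apply: eq_bigr => s _.
by rewrite /w /=; ring.
Qed.

(** The coordinates [k j] are distinct, so the factors can be integrated out one at a time: those
    still present do not see the coordinate being removed. *)
Lemma pE_indep_prod (J : eqType) (r : seq J) (k : J -> E) (g : J -> S -> R) f :
  uniq (map k r) -> (forall j, j \in r -> indep (k j) f) ->
  pE (fun G => f G * \prod_(j <- r) g j (G (k j)))
  = pE f * \prod_(j <- r) \sum_s h (k j) s * g j s.
Proof.
elim: r => [|j r IH] /=.
  by rewrite big_nil mulr1 => _ _; apply: eq_pE => G; rewrite big_nil mulr1.
move=> /andP[jr ur] fr.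
rewrite big_cons mulrCA mulrC -IH //; last first.
  by move=> i ir; apply: fr; rewrite inE ir orbT.
rewrite -pE_indep; first by apply: eq_pE => G; rewrite big_cons; ring.
move=> G s; rewrite fr ?mem_head//; congr (_ * _).
apply: eq_big_seq => i ir; rewrite ffunE; case: eqP => // kij.
by case/negP: jr; rewrite -kij map_f.
Qed.

Hypothesis h0 : forall e s, 0 <= h e s.

Lemma weight_ge0 G : 0 <= \prod_e h e (G e).
Proof. by apply: prodr_ge0 => e _. Qed.

Lemma le_pE f g : (forall G, f G <= g G) -> pE f <= pE g.
Proof. by move=> fg; apply: ler_sum => G _; rewrite ler_wpM2l// weight_ge0. Qed.

Lemma pE_ge0 f : (forall G, 0 <= f G) -> 0 <= pE f.
Proof. by move=> f0; apply: sumr_ge0 => G _; rewrite mulr_ge0// weight_ge0. Qed.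

End ProductExpectation.

(** * Pairs of vertices and the law of the observation *)

Section Pairs.
Variable n : nat.
Implicit Types (e : upair n) (G : observation n) (u v w : 'I_n).

(* [e0] is only a default value, used when v = w. *)
Definition edge e0 v w : upair n := insubd e0 [set v; w]%SET.

Lemma val_edge e0 v w : v != w -> val (edge e0 v w) = [set v; w]%SET.
Proof. by move=> vw; rewrite val_insubd cards2 vw. Qed.

Lemma pair_statusE e0 G v w : v != w -> pair_status G v w = G (edge e0 v w).
Proof.
move=> vw; rewrite /pair_status /edge /insubd.
by case: insubP => //=; rewrite cards2 vw.
Qed.

Lemma pair_status_upd G e s v w : val e != [set v; w]%SET ->
  pair_status (upd G e s) v w = pair_status G v w.
Proof.
move=> evw; rewrite /pair_status; case: insubP => //= e' _ e'vw.
by rewrite ffunE; case: eqP => // ee'; rewrite -e'vw ee' eqxx in evw.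
Qed.

Lemma edge_inj e0 v w w' : v != w -> v != w' ->
  edge e0 v w = edge e0 v w' -> w = w'.
Proof.
move=> vw vw' /(congr1 val); rewrite !val_edge// => /setP/(_ w).
rewrite !inE eqxx orbT eq_sym (negbTE vw) /=.
by move/esym/eqP.
Qed.

Lemma upair_other e v : v \in val e -> exists2 w, v != w & val e = [set v; w]%SET.
Proof.
case: e => /= e /cards2P[x [y [xy ->]]]; rewrite !inE => /orP[]/eqP->.
  by exists y.
by exists x; rewrite 1?eq_sym// finset.setUC.
Qed.

Lemma big_edges (T : Type) (idx : T) (op : Monoid.com_law idx) e0 v
    (F : upair n -> T) :
  \big[op/idx]_(e : upair n | v \in val e) F e
  = \big[op/idx]_(w | w != v) F (edge e0 v w).
Proof.
pose other e := odflt v [pick w | (v != w) && (val e == [set v; w]%SET)].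
have edgeK w : v != w -> other (edge e0 v w) = w.
  move=> vw; rewrite /other; case: pickP => [w' /andP[vw' /eqP]|/(_ w)] /=.
    move=> eq; apply/esym/(@edge_inj e0 v) => //.
    by apply: val_inj; apply: (etrans eq); rewrite val_edge.
  by rewrite vw val_edge// eqxx.
rewrite (reindex_onto (edge e0 v) other) => /= [|e /upair_other[w vw evw]].
  apply: eq_bigl => w; have [->|vw] := eqVneq w v; last first.
    by rewrite val_edge 1?eq_sym// !inE eqxx edgeK ?eqxx// eq_sym.
  (* At the index w = v, [edge] falls back on e0; this index is excluded because [other] never
     returns v on a pair that contains v. *)
  apply/negP => /andP[/upair_other[w' vw' evw']].
  rewrite /other; case: pickP => [w'' /andP[vw'' _] /= /eqP eq|/(_ w')].
    by rewrite eq eqxx in vw''.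
  by rewrite vw' evw' eqxx.
suff -> : e = edge e0 v w by rewrite edgeK.
by apply: val_inj; rewrite val_edge.
Qed.

Lemma upair_inhabited : (1 < n)%N -> upair n.
Proof.
move=> n1; exists [set Ordinal (ltnW n1); Ordinal n1]%SET.
by rewrite cards2.
Qed.

End Pairs.

Lemma sum_status (R : nmodType) (F : status -> R) :
  \sum_s F s = F present + F absent + F censored.
Proof.
rewrite (bigD1 present)//= (bigD1 absent)//= (bigD1 censored)//= big_pred0.
  by rewrite addr0 addrA.
by case=> [[]|].
Qed.

(** * The law of the observation given the labels *)

Section Weights.
Variables (R : realType) (p1 p2 q : R) (n : nat).
Implicit Types (a p : R) (sigma : labels n) (G : observation n).

Definition status_prob a p (s : status) : R :=
  match s with
  | Some b => a * bern p b
  | None => 1 - a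
  end.

Lemma sum_status_prob a p : \sum_s status_prob a p s = 1.
Proof. by rewrite sum_status /=; ring. Qed.

Lemma status_prob_ge0 a p s : 0 <= a <= 1 -> 0 <= p <= 1 ->
  0 <= status_prob a p s.
Proof.
case/andP=> a0 a1 /andP[p0 p1'].
by case: s => [[]|] /=; rewrite ?mulr_ge0 ?subr_ge0.
Qed.

Definition pair_prob (b b' : bool) : R :=
  if b then (if b' then p1 else q) else (if b' then q else p2).

Lemma edge_prob_set2 sigma (e : upair n) v w : val e = [set v; w]%SET ->
  edge_prob p1 p2 q sigma e = pair_prob (sigma v) (sigma w).
Proof.
move=> evw; rewrite /edge_prob evw.
have H (P : pred 'I_n) : [forall x in [set v; w]%SET, P x] = P v && P w.
  apply/forall_inP/andP => [H|[Pv Pw] x]; last by rewrite !inE => /orP[]/eqP->.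
  by split; apply: H; rewrite !inE eqxx ?orbT.
by rewrite !H /pair_prob; case: (sigma v); case: (sigma w).
Qed.

Lemma edge_probP sigma (e : upair n) :
  exists b b', edge_prob p1 p2 q sigma e = pair_prob b b'.
Proof.
rewrite /edge_prob; case: ifP => _; first by exists true, true.
case: ifP => _; first by exists false, false.
by exists true, false.
Qed.

Definition pair_weight a sigma (e : upair n) (s : status) : R :=
  status_prob a (edge_prob p1 p2 q sigma e) s.

Definition cE a sigma (f : observation n -> R) : R := pE (pair_weight a sigma) f.

Definition cmass a sigma G : R := \prod_e pair_weight a sigma e (G e).

Definition EE a (F : labels n -> observation n -> R) : R :=
  2^-1 ^+ n * \sum_sigma cE a sigma (F sigma).

Lemma sum_pair_weight a sigma e : \sum_s pair_weight a sigma e s = 1.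
Proof. exact: sum_status_prob. Qed.

(** Given the labels, the statuses of the pairs are independent, so the graph and the revealed set
    can be summed out pair by pair. All later estimates are made for labels and observations. *)
Lemma Ex_sigma0_obs t F :
  Ex p1 p2 q t (fun w : sample n => F (sigma0 w) (obs w)) = EE (alpha t n) F.
Proof.
set a := alpha t n.
pose k sigma (e : upair n) b b' := bern (edge_prob p1 p2 q sigma e) b * bern a b'.
pose m sigma (A B : {ffun upair n -> bool}) := \prod_e k sigma e (A e) (B e).
pose st (b b' : bool) : status := if b' then Some b else censored.
transitivity (\sum_sigma \sum_(A : {ffun upair n -> bool})
    \sum_(B : {ffun upair n -> bool})
    2^-1 ^+ n * m sigma A B * F sigma [ffun e => st (A e) (B e)]).
  rewrite pair_bigA /= pair_bigA /=; apply: eq_bigr => w _.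
  by congr (_ * _).
rewrite /EE mulr_sumr; apply: eq_bigr => sigma _.
under eq_bigr do under eq_bigr do rewrite -mulrA.
under eq_bigr do rewrite -mulr_sumr.
rewrite -mulr_sumr; congr (_ * _).
(* The constraint that G is the observation of A and B is a product of indicators over the pairs.
   Summing over A and B for fixed G then factorises. *)
transitivity (\sum_(A : {ffun upair n -> bool})
    \sum_(B : {ffun upair n -> bool}) \sum_(G : observation n)
    F sigma G * \prod_e (k sigma e (A e) (B e) * (G e == st (A e) (B e))%:R)).
  apply: eq_bigr => A _; apply: eq_bigr => B _.
  rewrite (bigD1 [ffun e => st (A e) (B e)])//= [X in _ + X]big1 ?addr0.
    rewrite mulrC; congr (_ * _); apply: eq_bigr => e _.
    by rewrite ffunE eqxx mulr1.
  move=> G GAB; have [e Ge] : exists e, G e != st (A e) (B e).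
    apply/existsP; apply: contraR GAB => /existsPn GAB.
    by apply/eqP/ffunP => e; rewrite ffunE; apply/eqP; have := GAB e; rewrite negbK.
  by rewrite (bigD1 e)//= (negbTE Ge) mulr0 mul0r mulr0.
under eq_bigr do rewrite exchange_big.
rewrite exchange_big /=; apply: eq_bigr => G _.
under eq_bigr do rewrite -mulr_sumr.
rewrite -mulr_sumr mulrC; congr (_ * _).
transitivity (\sum_(A : {ffun upair n -> bool})
    \prod_e \sum_b' k sigma e (A e) b' * (G e == st (A e) b')%:R).
  by apply: eq_bigr => A _; rewrite bigA_distr_bigA.
rewrite -(bigA_distr_bigA (fun e b =>
  \sum_b' k sigma e b b' * (G e == st b b')%:R)) /=.
apply: eq_bigr => e _; rewrite !big_bool /k /pair_weight /st.
by case: (G e) => [[]|]; rewrite /= ?eqxx /=; ring.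
Qed.

Lemma EE1 a : EE a (fun _ _ => 1) = 1.
Proof.
rewrite /EE (eq_bigr (fun=> 1)) => [|sigma _]; last first.
  by apply: pE1 => e; exact: sum_pair_weight.
by rewrite sumr_const card_ffun card_bool card_ord natrX -exprMn mulVf ?expr1n.
Qed.

Hypotheses (hp1 : 0 < p1 < 1) (hp2 : 0 < p2 < 1) (hq : 0 < q < 1).

Lemma pair_prob_bounds b b' : 0 < pair_prob b b' < 1.
Proof. by rewrite /pair_prob; case: b; case: b'. Qed.

Variable a : R.
Hypothesis ha : 0 <= a <= 1.

Lemma pair_weight_ge0 sigma e s : 0 <= pair_weight a sigma e s.
Proof.
have [b [b' eb]] := edge_probP sigma e.
rewrite /pair_weight eb; apply: status_prob_ge0 => //.
by have /andP[/ltW-> /ltW->] := pair_prob_bounds b b'.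
Qed.

Lemma le_cE sigma f g : (forall G, f G <= g G) -> cE a sigma f <= cE a sigma g.
Proof. exact: (le_pE (@pair_weight_ge0 sigma)). Qed.

Lemma cE_ge0 sigma f : (forall G, 0 <= f G) -> 0 <= cE a sigma f.
Proof. exact: (pE_ge0 (@pair_weight_ge0 sigma)). Qed.

Lemma le_EE F F' : (forall sigma G, F sigma G <= F' sigma G) ->
  EE a F <= EE a F'.
Proof.
move=> FF'; rewrite /EE ler_wpM2l ?exprn_ge0 ?invr_ge0//.
by apply: ler_sum => sigma _; apply: le_cE.
Qed.

Lemma EE_ge0 F : (forall sigma G, 0 <= F sigma G) -> 0 <= EE a F.
Proof.
move=> F0; rewrite /EE mulr_ge0 ?exprn_ge0 ?invr_ge0//.
by apply: sumr_ge0 => sigma _; apply: cE_ge0.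
Qed.

Lemma EED F F' :
  EE a (fun sigma G => F sigma G + F' sigma G) = EE a F + EE a F'.
Proof.
rewrite /EE -mulrDr -big_split; congr (_ * _).
by apply: eq_bigr => sigma _; rewrite /cE pED.
Qed.

Lemma EEZ c F : EE a (fun sigma G => c * F sigma G) = c * EE a F.
Proof.
rewrite /EE [in RHS]mulrCA; congr (_ * _); rewrite mulr_sumr.
by apply: eq_bigr => sigma _; rewrite /cE pEZ.
Qed.

Lemma EE_sum (I : finType) (P : pred I) F :
  EE a (fun sigma G => \sum_(i | P i) F i sigma G) = \sum_(i | P i) EE a (F i).
Proof.
rewrite /EE -mulr_sumr; congr (_ * _); rewrite [RHS]exchange_big.
by apply: eq_bigr => sigma _; rewrite /cE pE_sum.
Qed.

(* The function f may still depend on all the pairs not joining v to the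
   complement of U. *)
Lemma tilt sigma v (U : {set 'I_n}) (g : 'I_n -> status -> R) f : v \in U ->
  (forall e w, w \notin U -> val e = [set v; w]%SET -> indep e f) ->
  cE a sigma (fun G => f G * \prod_(w | w \notin U) g w (pair_status G v w))
  = cE a sigma f *
    \prod_(w | w \notin U) \sum_s status_prob a (pair_prob (sigma v) (sigma w)) s * g w s.
Proof.
move=> vU fU.
have neq w : w \notin U -> v != w by apply: contraNneq => <-.
(* A default pair is needed for [edge]. Without any pair the complement of U is empty, since w
   outside U would form a pair with v, and both products are 1. *)
have [e0|no_upair] := pselect (inhabited (upair n)); last first.
  have [w wU|U0] := pickP [pred w | w \notin U].
    case: no_upair; constructor; exists [set v; w]%SET.
    by rewrite cards2 neq.
  by rewrite big_pred0// mulr1; apply: eq_pE => G; rewrite big_pred0// mulr1.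
case: e0 => e0.
pose r := [seq w <- index_enum 'I_n | w \notin U].
have rE w : w \in r = (w \notin U) by rewrite mem_filter mem_index_enum andbT.
have e0E w : w \in r -> val (edge e0 v w) = [set v; w]%SET.
  by rewrite rE => wU; rewrite val_edge// neq.
transitivity (cE a sigma (fun G => f G * \prod_(w <- r) g w (G (edge e0 v w)))).
  apply: eq_pE => G; rewrite big_filter; congr (_ * _); apply: eq_bigr => w wU.
  by rewrite (pair_statusE e0)// neq.
rewrite /cE (pE_indep_prod (@sum_pair_weight a sigma)).
- rewrite big_filter; congr (_ * _); apply: eq_bigr => w wU.
  apply: eq_bigr => s _; congr (_ * _); rewrite /pair_weight (@edge_prob_set2 _ _ v w)//.
  by rewrite e0E// rE.
- rewrite map_inj_in_uniq ?filter_uniq ?index_enum_uniq//.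
  move=> x y; rewrite !rE => xU yU; apply: edge_inj; exact: neq.
- move=> w wr; apply: (fU _ w); last exact: e0E.
  by rewrite -rE.
Qed.

End Weights.

(** * The genie as a likelihood ratio test *)

Section Genie.
Variables (R : realType) (p1 p2 q : R) (n : nat).
Hypotheses (hp1 : 0 < p1 < 1) (hp2 : 0 < p2 < 1) (hq : 0 < q < 1).
Implicit Types (sigma : labels n) (G : observation n) (u v : 'I_n).

Local Notation pair_prob := (pair_prob p1 p2 q).
Local Notation Gamma := (Gamma p1 p2 q).
Local Notation cmass := (cmass p1 p2 q).
Local Notation EE := (EE p1 p2 q).

(* The log-likelihood ratio of the labels + and - of one end of a pair, when b
   is the label of the other end and s is the status of the pair. *)
Definition llr (b : bool) (s : status) : R :=
  if s is Some e then ln (bern (pair_prob true b) e / bern (pair_prob false b) e) else 0.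

Lemma bern_gt0 (p : R) e : 0 < p < 1 -> 0 < bern p e.
Proof. by case/andP=> p0 p1'; case: e => //=; rewrite subr_gt0. Qed.

Lemma status_prob_llr a b s :
  status_prob a (pair_prob true b) s = expR (llr b s) * status_prob a (pair_prob false b) s.
Proof.
case: s => [e|]; last by rewrite /= expR0 mul1r.
rewrite /status_prob /llr.
have ep0 b' : 0 < bern (pair_prob b' b) e by rewrite bern_gt0 ?pair_prob_bounds.
rewrite lnK; last by rewrite posrE divr_gt0.
by rewrite mulrCA divfK// gt_eqF.
Qed.

Lemma GammaE G u sigma :
  Gamma G u sigma = \sum_(v | v != u) llr (sigma v) (pair_status G u v).
Proof.
have DcountE s st : (Dcount G sigma u s st)%:R
    = \sum_(v | v != u) ((sigma v == s) && (pair_status G u v == st))%:R :> R.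
  rewrite /Dcount -sum1_card natr_sum big_mkcond [RHS]big_mkcond /=.
  apply: eq_bigr => v _; rewrite inE; case: (v != u) => //=.
  by case: (_ && _).
rewrite /Defs.Gamma !DcountE !mulr_suml -!big_split /=; apply: eq_bigr => v _.
case: (sigma v); case: (pair_status G u v) => [[]|] /=;
  by rewrite ?eqxx /= !(mul0r, mul1r, addr0, add0r).
Qed.

Lemma eq_Gamma G u sigma sigma' :
  (forall v, v != u -> sigma v = sigma' v) -> Gamma G u sigma = Gamma G u sigma'.
Proof.
by move=> eq_s; rewrite !GammaE; apply: eq_bigr => v vu; rewrite eq_s.
Qed.

Lemma Gamma_upd G u sigma b : Gamma G u (upd sigma u b) = Gamma G u sigma.
Proof. by apply: eq_Gamma => v /negbTE vu; rewrite ffunE vu. Qed.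

Lemma indep_Gamma (e : upair n) sigma u (f : R -> R) :
  u \notin val e ->
  indep e (fun G : {ffun upair n -> status} => f (Gamma G u sigma)).
Proof.
move=> ue G s; congr f; rewrite !GammaE; apply: eq_bigr => v _.
rewrite pair_status_upd//; apply: contraNneq ue => ->.
by rewrite !inE eqxx.
Qed.

Hypothesis hn : (1 < n)%N.

(** Only the pairs at u feel the label of u, and each contributes its own likelihood ratio.
    [Gamma G u sigma] itself ignores the label of u, so the same ratio serves from both sides of the
    flip. *)
Lemma cmass_flip a sigma G u :
  cmass a (upd sigma u true) G
  = expR (Gamma G u sigma) * cmass a (upd sigma u false) G.
Proof.
have e0 := upair_inhabited hn.
have split_at b : cmass a (upd sigma u b) G =
    (\prod_(v | v != u) status_prob a (pair_prob b (sigma v)) (pair_status G u v)) *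
    \prod_(e : upair n | u \notin val e) pair_weight p1 p2 q a sigma e (G e).
  rewrite /cmass (bigID (fun e : upair n => u \in val e)) /=; congr (_ * _).
    rewrite (big_edges _ e0); apply: eq_bigr => v vu.
    rewrite (pair_statusE e0) 1?eq_sym// /pair_weight (@edge_prob_set2 _ _ _ _ _ _ _ u v).
      by rewrite !ffunE eqxx (negbTE vu).
    by rewrite val_edge// eq_sym.
  apply: eq_bigr => e ue; rewrite /pair_weight; congr status_prob; rewrite /edge_prob.
  have eq_forall (f : bool -> bool) :
      [forall v in val e, f (upd sigma u b v)] = [forall v in val e, f (sigma v)].
    apply: eq_forallb_in => v ve; rewrite ffunE; case: eqP => // vu.
    by rewrite vu (negbTE ue) in ve.
  by rewrite (eq_forall id) (eq_forall negb).
rewrite !split_at mulrA; congr (_ * _).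
rewrite GammaE (big_morph _ (@expRD R) (@expR0 R)) -big_split; apply: eq_bigr => v _.
by rewrite status_prob_llr.
Qed.

Lemma cmass_gt0 a sigma G : 0 < a < 1 -> 0 < cmass a sigma G.
Proof.
move=> /andP[a0 a1]; apply: prodr_gt0 => e _; rewrite /pair_weight.
have [b [b' ->]] := edge_probP p1 p2 q sigma e.
by case: (G e) => [s|] /=; rewrite ?mulr_gt0 ?subr_gt0 ?bern_gt0 ?pair_prob_bounds.
Qed.

Lemma Pr_Ex t (P : pred (sample n)) :
  Pr p1 p2 q t P = Ex p1 p2 q t (fun w => (P w)%:R).
Proof.
by rewrite /Pr big_mkcond; apply: eq_bigr => w _; case: (P w); rewrite ?mulr1 ?mulr0.
Qed.

Lemma EE_dirac a sigma G :
  EE a (fun sigma' G' => ((sigma' == sigma) && (G' == G))%:R)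
  = 2^-1 ^+ n * cmass a sigma G.
Proof.
rewrite /EE; congr (_ * _); rewrite (bigD1 sigma)//= [X in _ + X]big1 ?addr0.
  rewrite /cE /pE (bigD1 G)//= [X in _ + X]big1 ?addr0 => [|G' /negbTE->].
    by rewrite !eqxx mulr1.
  by rewrite andbF mulr0.
by move=> s /negbTE->; rewrite /cE /pE big1// => G' _; rewrite mulr0.
Qed.

(** The two posteriors share the normaliser [Pr F], positive because 0 < alpha < 1 makes every mass
    positive. Comparing them amounts to comparing two masses whose ratio is e^Gamma, and both sides
    resolve ties towards +1. *)
Lemma sigma_bestE t (w : sample n) : 0 < alpha t n < 1 ->
  sigma_best p1 p2 q t w = [ffun u => 0 <= Gamma (obs w) u (sigma0 w)].
Proof.
move=> a01; have a01' : 0 <= alpha t n <= 1.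
  by case/andP: a01 => /ltW-> /ltW->.
apply/ffunP => u; rewrite !ffunE /posterior /cond_Pr.
set F := [pred w' | _ && _].
have PrE r : Pr p1 p2 q t (predI [pred w' | sigma0 w' u == r] F)
    = 2^-1 ^+ n * cmass (alpha t n) (upd (sigma0 w) u r) (obs w).
  rewrite -EE_dirac -Ex_sigma0_obs Pr_Ex; congr (Ex _ _ _ _ _).
  apply/funext => w' /=; congr (_ : bool)%:R.
  rewrite andbCA andbC; congr (_ && _).
  apply/andP/eqP => [[/eqP ur /forallP eqv]|->].
    apply/ffunP => v; rewrite ffunE; have [->//|vu] := eqVneq v u.
    by have := eqv v; rewrite vu /= => /eqP.
  rewrite ffunE eqxx; split => //; apply/forallP => v; apply/implyP => /negbTE vu.
  by rewrite ffunE vu.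
have F0 : 0 < Pr p1 p2 q t F.
  have := PrE true; rewrite !Pr_Ex.
  rewrite (Ex_sigma0_obs _ _ _ _ (fun s G => ((s u == true) && ((G == obs w) &&
    [forall v, (v != u) ==> (s v == sigma0 w v)]))%:R)).
  rewrite (Ex_sigma0_obs _ _ _ _ (fun s G => ((G == obs w) &&
    [forall v, (v != u) ==> (s v == sigma0 w v)])%:R)) => eqT.
  apply: (@lt_le_trans _ _ (2^-1 ^+ n * cmass (alpha t n) (upd (sigma0 w) u true) (obs w))).
    by rewrite mulr_gt0 ?exprn_gt0 ?invr_gt0 ?cmass_gt0.
  by rewrite -eqT; apply: le_EE => // s G; case: (s u == true); rewrite ?lexx ?ler0n.
rewrite ler_pM2r ?invr_gt0// !PrE ler_pM2l ?exprn_gt0 ?invr_gt0//.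
by rewrite cmass_flip ler_pMl ?cmass_gt0// -expR0 ler_expR.
Qed.

End Genie.

(** * Misclassification by degrees *)

Section RealInequalities.
Variable R : realType.
Implicit Types x : R.

(* From e^(-x) >= 1 - x. *)
Lemma expR_le_quadratic x : x <= 2^-1 -> expR x <= 1 + x + 2 * x ^+ 2.
Proof.
move=> x2; have x1 : 0 < 1 - x by lra.
have xe : (1 - x) * expR x <= 1.
  by rewrite -[leRHS](expRxMexpNx_1 x) mulrC ler_wpM2l ?expR_ge0 ?expR_ge1Dx.
rewrite -(ler_pM2l x1); apply: (le_trans xe).
rewrite -subr_ge0 (_ : _ - 1 = x ^+ 2 * (1 - 2 * x)); last by ring.
by rewrite mulr_ge0 ?sqr_ge0//; lra.
Qed.

End RealInequalities.

Section Degrees.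
Variables (R : realType) (p1 p2 q t : R) (n : nat).
Hypotheses (hp1 : 0 < p1 < 1) (hp2 : 0 < p2 < 1) (hq : 0 < q < 1).
Hypotheses (n0 : (0 < n)%N) (ha : 0 <= alpha t n <= 1).
Implicit Types (sigma : labels n) (G : observation n) (u v w : 'I_n).

Local Notation pair_prob := (pair_prob p1 p2 q).
Local Notation a := (alpha t n).
Local Notation cE := (cE p1 p2 q a).
Local Notation tlogn := (t * ln n%:R).
Local Notation hat := (fun G => oriented p1 p2 (sigma_deg p1 p2 q t G)).

(** For communities of equal size, [tlogn * gap] is the distance from [cutoff] to the expected
    degree in either community; see [dsign_gap]. *)
Definition gap : R := `|p1 - p2| / 4.

(* The sign is + for the community with the larger expected degrees. *)
Definition dsign (b : bool) : R := if b == (p2 < p1) then 1 else -1.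

(** With this tolerance the imbalance of the communities shifts an expected degree by at most a
    quarter of [tlogn * gap]. *)
Definition balanced sigma : bool :=
  `|\sum_w (sigma w)%:R - n%:R / 2| <= gap / 4 * n%:R.

Definition cutoff : R := tlogn / 4 * (p1 + p2 + 2 * q).

Definition is_present (s : status) : R := (s == present)%:R.

Lemma dsign_sqr b : dsign b * dsign b = 1.
Proof. by rewrite /dsign; case: ifP => _; rewrite ?mulrNN mulr1. Qed.

Lemma normr_dsign b : `|dsign b| = 1.
Proof. by rewrite /dsign; case: ifP => _; rewrite ?normrN1 ?normr1. Qed.

Lemma gap_ge0 : 0 <= gap.
Proof. by rewrite divr_ge0. Qed.

Lemma gap_le : gap <= 4^-1.
Proof.
move: hp1 hp2 => /andP[? ?] /andP[? ?].
rewrite /gap; have : `|p1 - p2| <= 1 by rewrite ler_norml; apply/andP; split; lra.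
lra.
Qed.

Lemma degE G v : (deg G v)%:R = \sum_w is_present (pair_status G v w).
Proof.
rewrite /deg -sum1_card natr_sum big_mkcond; apply: eq_bigr => w _.
by rewrite inE /is_present; case: (_ == _).
Qed.

Lemma mislabeled_deg G sigma v :
  hat G v != sigma v -> dsign (sigma v) * ((deg G v)%:R - cutoff) <= 0.
Proof.
rewrite /oriented /signed /dsign !ffunE -/cutoff.
have : (p2 < p1) \in [:: true; false] by case: (p2 < p1).
case: (p2 < p1) => _; case: (sigma v) => /=; case: leP => //=; rewrite ?eqxx /=; lra.
Qed.

Definition slope : R := gap / 4.

Lemma slope_ge0 : 0 <= slope.
Proof. by rewrite divr_ge0// gap_ge0. Qed.

Lemma slope_le : slope <= 2^-1.
Proof. by rewrite /slope; have := gap_le; lra. Qed.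

(** The exponential moment variable of the event that the degree of v, counted outside U only, lies
    on the wrong side of [cutoff]. *)
Definition deg_tilt (U : {set 'I_n}) sigma v G : R :=
  expR (slope * dsign (sigma v) * cutoff) *
  \prod_(w | w \notin U)
    expR (- (slope * dsign (sigma v)) * is_present (pair_status G v w)).

Lemma deg_tilt_ge0 U sigma v G : 0 <= deg_tilt U sigma v G.
Proof. by rewrite mulr_ge0 ?expR_ge0// prodr_ge0// => w _; exact: expR_ge0. Qed.

(* Markov's exponential trick; dropping the pairs between v and U only costs a
   constant factor, and leaves pairs that are disjoint for distinct v in U. *)
Lemma mislabeled_le (U : {set 'I_n}) sigma v G :
  (hat G v != sigma v)%:R <= expR (slope * #|U|%:R) * deg_tilt U sigma v G.
Proof.
case: (boolP (hat G v != sigma v)) => [/mislabeled_deg mis|_]; last first.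
  by rewrite mulr_ge0 ?expR_ge0 ?deg_tilt_ge0.
rewrite /deg_tilt -(big_morph _ (@expRD R) (@expR0 R)) -!expRD.
rewrite -[X in X <= _](@expR0 R) ler_expR -mulr_sumr.
move: mis; rewrite degE (bigID (mem U)) /=.
set s1 := \sum_(w in U) _; set s2 := \sum_(w | _) _ => mis.
have s10 : 0 <= s1 by apply: sumr_ge0 => w _; exact: ler0n.
have s1U : s1 <= #|U|%:R.
  rewrite -sum1_card natr_sum; apply: ler_sum => w _.
  by rewrite /is_present; case: (_ == _).
have d1 : - (dsign (sigma v) * s1) <= #|U|%:R.
  rewrite (le_trans _ s1U)// -[leRHS]mul1r -(normr_dsign (sigma v)) -mulNr.
  by rewrite ler_wpM2r// -normrN ler_norm.
have := ler_wpM2l slope_ge0 mis; have := ler_wpM2l slope_ge0 d1.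
lra.
Qed.

Lemma sum_pair_prob b sigma : \sum_w pair_prob b (sigma w)
  = (\sum_w (sigma w)%:R) * (pair_prob b true - pair_prob b false) + n%:R * pair_prob b false.
Proof.
rewrite mulr_suml [n%:R * _]mulr_natl -[X in _ *+ X](card_ord n) -sumr_const.
rewrite -big_split.
by apply: eq_bigr => w _; case: (sigma w) => /=; rewrite ?mul1r ?mul0r ?subrK ?add0r.
Qed.

Lemma dsign_gap b :
  dsign b * (tlogn * ((pair_prob b true + pair_prob b false) / 2) - cutoff) = tlogn * gap.
Proof.
rewrite /dsign /gap /cutoff /pair_prob; have [p21|p12] := ltP p2 p1.
  by rewrite gtr0_norm ?subr_gt0//; case: b => /=; field.
by rewrite ler0_norm ?subr_le0//; case: b => /=; field.
Qed.

Lemma alphaM : a * n%:R = tlogn.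
Proof. by rewrite /alpha divfK// pnatr_eq0 -lt0n. Qed.

(** Apply e^x <= 1 + x + 2 x^2, where the sign disappears from the square, and then 1 + z <= e^z. *)
Lemma deg_tilt_factor b b' :
  \sum_s status_prob a (pair_prob b b') s * expR (- (slope * dsign b) * is_present s)
  <= expR (a * pair_prob b b' * (- (slope * dsign b) + 2 * slope ^+ 2)).
Proof.
have /andP[e0 e1] := pair_prob_bounds hp1 hp2 hq b b'; have /andP[a0 a1] := ha.
rewrite sum_status /status_prob /is_present /= !mulr0 !expR0.
set x := - (slope * dsign b).
have x2 : x ^+ 2 = slope ^+ 2.
  by rewrite sqrrN exprMn [dsign b ^+ 2]expr2 dsign_sqr mulr1.
have : expR x <= 1 + x + 2 * slope ^+ 2.
  rewrite -x2 expR_le_quadratic// (le_trans _ slope_le)//.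
  rewrite -[leRHS]mulr1 -(normr_dsign b) /x -mulrN ler_wpM2l ?slope_ge0//.
  by rewrite -normrN ler_norm.
move=> ex; apply: le_trans (expR_ge1Dx _).
have /(ler_wpM2l (mulr_ge0 a0 (ltW e0))) := ex.
by rewrite !mulr1; lra.
Qed.

(** The drift [slope * gap] loses at most [slope * gap / 4] to the imbalance and [2 * slope ^+ 2] to
    the quadratic term. With slope = gap / 4 this leaves gap^2 / 16 in front of [tlogn]; the pairs
    between v and U cost the constant factor. *)
Lemma deg_tilt_prod (U : {set 'I_n}) sigma v : balanced sigma ->
  expR (slope * dsign (sigma v) * cutoff) *
  (\prod_(w | w \notin U) \sum_s status_prob a (pair_prob (sigma v) (sigma w)) s *
     expR (- (slope * dsign (sigma v)) * is_present s))
  <= expR (slope * #|U|%:R) * expR (- (gap ^+ 2 / 16 * tlogn)).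
Proof.
move=> bal; set b := sigma v; have /andP[a0 a1] := ha.
have epP b' := pair_prob_bounds hp1 hp2 hq b b'.
apply: (@le_trans _ _ (expR (slope * dsign b * cutoff) * \prod_(w | w \notin U)
    expR (a * pair_prob b (sigma w) * (- (slope * dsign b) + 2 * slope ^+ 2)))).
  rewrite ler_wpM2l ?expR_ge0//; apply: ler_prod => w _.
  rewrite deg_tilt_factor andbT; apply: sumr_ge0 => s _.
  rewrite mulr_ge0 ?expR_ge0// status_prob_ge0//.
  by have /andP[/ltW-> /ltW->] := epP (sigma w).
rewrite -(big_morph _ (@expRD R) (@expR0 R)) -!expRD ler_expR.
rewrite -mulr_suml -mulr_sumr.
have sumU := sum_pair_prob b sigma; rewrite (bigID (mem U)) /= in sumU.
move: sumU; set s1 := \sum_(w in U) _; set s2 := \sum_(w | _) _.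
set N := \sum_w _ => sumU.
have s10 : 0 <= s1.
  by apply: sumr_ge0 => w _; have /andP[/ltW] := epP (sigma w).
have s1U : s1 <= #|U|%:R.
  rewrite -sum1_card natr_sum; apply: ler_sum => w _.
  by have /andP[_ /ltW] := epP (sigma w).
have s2n : s2 <= n%:R.
  apply: (@le_trans _ _ (\sum_(w < n | w \notin U) 1)).
    by apply: ler_sum => w _; have /andP[_ /ltW] := epP (sigma w).
  rewrite sumr_const ler_nat (leq_trans (max_card _))// card_ord//.
set d := dsign b; set m := N - n%:R / 2.
have dgap := dsign_gap b; rewrite -/d in dgap.
(* The mean degree outside U: its value for equal communities, a correction for the imbalance m, and
   the loss of the pairs to U. *)
have s2E : a * s2 = tlogn * ((pair_prob b true + pair_prob b false) / 2)
    + a * (m * (pair_prob b true - pair_prob b false)) - a * s1.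
  have -> : s2 = N * (pair_prob b true - pair_prob b false) + n%:R * pair_prob b false - s1.
    by rewrite -sumU; ring.
  by rewrite -alphaM /m; field.
have lam0 := slope_ge0.
have b1 : - (d * (a * (m * (pair_prob b true - pair_prob b false)))) <= gap / 4 * tlogn.
  apply: (le_trans (ler_norm _)); rewrite normrN normrM normr_dsign mul1r.
  rewrite normrM (ger0_norm a0) normrM -alphaM [leRHS]mulrCA ler_wpM2l//.
  rewrite -[leRHS]mulr1 ler_pM//.
  move: (epP true) (epP false) => /andP[? ?] /andP[? ?].
  by rewrite ler_norml; apply/andP; split; lra.
have b2 : d * (a * s1) <= #|U|%:R.
  apply: (le_trans (ler_norm _)); rewrite normrM normr_dsign mul1r.
  rewrite ger0_norm; last exact: mulr_ge0.
  by rewrite -[leRHS]mul1r; exact: ler_pM.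
have b3 : a * s2 <= tlogn by rewrite -alphaM ler_wpM2l.
have := ler_wpM2l lam0 b1; have := ler_wpM2l lam0 b2.
have := ler_wpM2l (sqr_ge0 slope) b3.
have -> : gap ^+ 2 / 16 * tlogn
    = slope * (tlogn * gap) - slope * (gap / 4 * tlogn) - 2 * (slope ^+ 2 * tlogn).
  by rewrite /slope; field.
have -> : slope * d * cutoff + a * s2 * (- (slope * d) + 2 * slope ^+ 2)
    = slope * (d * (cutoff - a * s2)) + 2 * (slope ^+ 2 * (a * s2)) by ring.
rewrite -dgap => h1 h2 h3; rewrite {1}s2E.
suff : slope * (d * (cutoff - (tlogn * ((pair_prob b true + pair_prob b false) / 2)
    + a * (m * (pair_prob b true - pair_prob b false)) - a * s1)))
  = - (slope * (d * (tlogn * ((pair_prob b true + pair_prob b false) / 2) - cutoff)))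
    + slope * (- (d * (a * (m * (pair_prob b true - pair_prob b false)))))
    + slope * (d * (a * s1)).
  lra.
by ring.
Qed.

Lemma indep_deg_tilt (e : upair n) (U : {set 'I_n}) sigma v :
  (forall w, w \notin U -> val e != [set v; w]%SET) ->
  indep e (deg_tilt U sigma v : {ffun upair n -> status} -> R).
Proof.
move=> eU G s; rewrite /deg_tilt; congr (_ * _); apply: eq_bigr => w wU.
by rewrite pair_status_upd ?eU.
Qed.

(** Here k.+1 is the size of U, that is, k mislabeled vertices and u. The factor 2 is there because
    [mislabeled_le] and [deg_tilt_prod] each cost e^(slope #|U|). *)
Definition mislabel_rate (k : nat) : R :=
  expR (2 * slope * k.+1%:R) * expR (- (gap ^+ 2 / 16 * tlogn)).

Lemma mislabel_rate_ge0 k : 0 <= mislabel_rate k.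
Proof. by rewrite mulr_ge0 ?expR_ge0. Qed.

(** Conditionally on the pairs at u, through which alone f sees G, the vertices of T behave as if
    independently mislabeled: each is controlled by its pairs to the complement of U, and these sets
    of pairs are disjoint and avoid u. *)
Lemma cE_mislabeled sigma u (T : {set 'I_n}) (f : observation n -> R) :
  balanced sigma -> u \notin T -> (forall G, 0 <= f G) ->
  (forall e : upair n, u \notin val e -> indep e f) ->
  cE sigma (fun G => f G * \prod_(v in T) (hat G v != sigma v)%:R)
  <= mislabel_rate #|T| ^+ #|T| * cE sigma f.
Proof.
move=> bal uT f0 indf; set U := (u |: T)%SET.
have cU : #|U| = #|T|.+1 by rewrite /U cardsU1 uT.
set c := expR (slope * #|U|%:R).
have c0 : 0 <= c by exact: expR_ge0.
pose Y r G := \prod_(v <- r) (c * deg_tilt U sigma v G).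
have Y0 r G : 0 <= Y r G.
  by apply: prodr_ge0 => v _; rewrite mulr_ge0// deg_tilt_ge0.
have rateE : mislabel_rate #|T|
    = c * (expR (slope * #|U|%:R) * expR (- (gap ^+ 2 / 16 * tlogn))).
  rewrite /mislabel_rate /c cU [RHS]mulrA -[in RHS]expRD; congr (expR _ * _); ring.
(* U stays fixed along the induction, so the base of the power is [mislabel_rate #|T|] at every
   step. *)
have step r : uniq r -> {subset r <= T} ->
    cE sigma (fun G => f G * Y r G) <= mislabel_rate #|T| ^+ size r * cE sigma f.
  elim: r => [|v r IH] /=.
    rewrite expr0 mul1r => _ _; apply: le_cE => // G.
    by rewrite /Y big_nil mulr1.
  move=> /andP[vr ur] vrT.
  have vT : v \in T by apply: vrT; rewrite mem_head.
  have rT : {subset r <= T} by move=> x xr; apply: vrT; rewrite inE xr orbT.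
  have vU : v \in U by rewrite !inE vT orbT.
  rewrite exprS -mulrA; apply: le_trans (ler_wpM2l (mislabel_rate_ge0 _) (IH ur rT)).
  rewrite [X in X <= _](_ : _ = c * expR (slope * dsign (sigma v) * cutoff) *
    cE sigma (fun G => (f G * Y r G) * \prod_(w | w \notin U)
      expR (- (slope * dsign (sigma v)) * is_present (pair_status G v w)))); last first.
    rewrite -pEZ; apply: eq_pE => G; rewrite /Y big_cons /deg_tilt; ring.
  rewrite (tilt _ _ _ _ _
    (fun _ s => expR (- (slope * dsign (sigma v)) * is_present s)) vU).
    rewrite rateE [leLHS]mulrCA [leRHS]mulrC.
    apply: ler_wpM2l; first by apply: cE_ge0 => // G; rewrite mulr_ge0.
    by rewrite -[leLHS]mulrA; apply: ler_wpM2l => //; exact: deg_tilt_prod.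
  (* A pair from v to the complement of U avoids u and every other vertex of T, so neither f nor the
     remaining tilts see it. *)
  move=> e w wU evw G s; rewrite indf; last first.
    rewrite evw !inE negb_or; apply/andP; split.
      by apply: contraNneq uT => ->.
    by apply: contraNneq wU => <-; rewrite !inE eqxx.
  congr (_ * _); apply: eq_big_seq => v' v'r; congr (_ * _).
  apply: (@indep_deg_tilt e) => w' w'U; rewrite evw.
  apply/negP => /eqP/setP/(_ v'); rewrite !inE eqxx /=.
  have -> /= : (v' == v) = false by apply/negbTE; apply: contraNneq vr => <-.
  by apply/negP; apply: contraNneq wU => <-; rewrite !inE rT// orbT.
apply: (@le_trans _ _ (cE sigma (fun G => f G * Y (enum T) G))); last first.
  rewrite [X in _ ^+ X]cardE; apply: step; first exact: enum_uniq.
  by move=> x; rewrite mem_enum.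
apply: le_cE => // G; rewrite ler_wpM2l// /Y big_enum.
by apply: ler_prod => v _; rewrite ler0n mislabeled_le.
Qed.

End Degrees.

(** * The two-step estimator against the genie *)

Section Comparison.
Variables (R : realType) (p1 p2 q t : R) (n : nat).
Hypotheses (hp1 : 0 < p1 < 1) (hp2 : 0 < p2 < 1) (hq : 0 < q < 1).
Hypotheses (n1 : (1 < n)%N) (ha : 0 <= alpha t n <= 1).
Implicit Types (sigma : labels n) (G : observation n) (u v w : 'I_n).

Local Notation pair_prob := (pair_prob p1 p2 q).
Local Notation llr := (llr p1 p2 q).
Local Notation a := (alpha t n).
Local Notation cE := (cE p1 p2 q a).
Local Notation EE := (EE p1 p2 q a).
Local Notation cmass := (cmass p1 p2 q a).
Local Notation Gamma := (Gamma p1 p2 q).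
Local Notation tlogn := (t * ln n%:R).
Local Notation gap := (gap p1 p2).
Local Notation balanced := (balanced p1 p2).
Local Notation rate := (mislabel_rate p1 p2 t n).
Local Notation hat := (fun G => oriented p1 p2 (sigma_deg p1 p2 q t G)).

Definition llr_bound : R := \sum_(x : bool * status) `|llr x.1 x.2|.

Lemma llr_le b s : `|llr b s| <= llr_bound.
Proof. by rewrite /llr_bound (bigD1 (b, s))//= lerDl sumr_ge0. Qed.

Lemma llr_bound_ge0 : 0 <= llr_bound.
Proof. exact: sumr_ge0. Qed.

Definition revealed u G : {set 'I_n} :=
  [set v | (v != u) && (pair_status G u v != censored)].

Definition revealed_mislabeled sigma u G : {set 'I_n} :=
  [set v in revealed u G | hat G v != sigma v].

Lemma Gamma_diff sigma u G :
  `|Gamma G u (hat G) - Gamma G u sigma|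
  <= 2 * llr_bound * #|revealed_mislabeled sigma u G|%:R.
Proof.
rewrite !GammaE -sumrB; apply: (le_trans (ler_norm_sum _ _ _)).
rewrite -sum1_card natr_sum mulr_sumr big_mkcond [leRHS]big_mkcond /=.
apply: ler_sum => v _; rewrite !inE; case: (v != u) => //=.
have [->|ns] := eqVneq (pair_status G u v) censored; first by rewrite subrr normr0.
have [->|_] /= := eqVneq (hat G v) (sigma v); first by rewrite subrr normr0.
rewrite mulr1 mulr_natl mulr2n (le_trans (ler_normB _ _))//.
by rewrite lerD ?llr_le.
Qed.

(** If two reals lie on different sides of 0, each is at most their distance in absolute value. *)
Lemma disagreement sigma u G :
  (0 <= Gamma G u (hat G)) != (0 <= Gamma G u sigma) ->
  (0 < #|revealed_mislabeled sigma u G|)%N /\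
  `|Gamma G u sigma| <= 2 * llr_bound * #|revealed_mislabeled sigma u G|%:R.
Proof.
move=> neq; have := Gamma_diff sigma u G; split.
  rewrite lt0n; apply: contraNneq neq => M0; move: (H).
  by rewrite M0 mulr0 normr_le0 subr_eq0 => /eqP->.
apply: le_trans H; move: neq.
case: (leP 0 (Gamma G u (hat G))) => h1; case: (leP 0 (Gamma G u sigma)) => h2 //= _.
  by rewrite ltr0_norm// ger0_norm; lra.
by rewrite ger0_norm// ltr0_norm; lra.
Qed.

Lemma card_draws_le (A : {set 'I_n}) k :
  (#|[set T : {set 'I_n} | T \subset A & #|T| == k]%SET| <= #|A| ^ k)%N.
Proof.
rewrite cards_draws; have : ('C(#|A|, k) * k`! <= #|A| ^ k)%N.
  rewrite bin_ffact; elim: k => [|k IH]; first by rewrite ffactn0.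
  by rewrite ffactnSr expnSr leq_mul// leq_subr.
by apply: leq_trans; rewrite leq_pmulr// fact_gt0.
Qed.

(** Union bound over the sets T of k revealed neighbours, of which there are at most L^k. Being
    revealed at u depends only on the pairs at u, so this event can be absorbed into the weight f of
    [cE_mislabeled]. *)
Lemma cE_revealed_mislabeled sigma u k (L : R) (f : observation n -> R) :
  balanced sigma -> 0 <= L -> (forall G, 0 <= f G) ->
  (forall e : upair n, u \notin val e -> indep e f) ->
  cE sigma (fun G => f G * ((#|revealed u G|%:R <= L) &&
                  (k <= #|revealed_mislabeled sigma u G|)%N)%:R)
  <= (rate k * L) ^+ k * cE sigma f.
Proof.
move=> bal L0 f0 indf.
pose F (T : {set 'I_n}) G : R :=
  f G * ((#|revealed u G|%:R <= L) && (T \subset revealed u G))%:R.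
have F0 T G : 0 <= F T G by rewrite mulr_ge0.
have indF T (e : upair n) : u \notin val e -> indep e (F T).
  move=> ue G s; rewrite /F indf//.
  suff -> : revealed u (upd G e s) = revealed u G by [].
  apply/setP => v; rewrite !inE pair_status_upd//.
  by apply: contraNneq ue => ->; rewrite !inE eqxx.
apply: (@le_trans _ _ (cE sigma (fun G =>
    \sum_(T : {set 'I_n} | (#|T| == k) && (u \notin T))
      F T G * \prod_(v in T) (hat G v != sigma v)%:R))).
  apply: le_cE => // G.
  have S0 (P : pred {set 'I_n}) : 0 <= \sum_(T : {set 'I_n} | P T)
      F T G * \prod_(v in T) (hat G v != sigma v)%:R.
    by apply: sumr_ge0 => T _; rewrite mulr_ge0 ?F0 ?prodr_ge0.
  case: andP => [[NL kM]|_]; last by rewrite mulr0.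
  have : (0 < #|[set T : {set 'I_n} | T \subset revealed_mislabeled sigma u G
                 & #|T| == k]%SET|)%N by rewrite cards_draws bin_gt0.
  case/card_gt0P => T; rewrite inE => /andP[/fintype.subsetP TM Tk].
  have uT : u \notin T by apply/negP => /TM; rewrite !inE eqxx.
  rewrite (bigD1 T) ?Tk ?uT//= -[leLHS]addr0 lerD//.
  rewrite /F NL /= [X in _ * X * _](_ : _ = 1); last first.
    suff -> : T \subset revealed u G by [].
    by apply/fintype.subsetP => v /TM; rewrite inE => /andP[].
  rewrite big1 ?mulr1// => v /TM; rewrite inE => /andP[_ ->] //.
rewrite /cE pE_sum; apply: (@le_trans _ _ (\sum_(T : {set 'I_n} |
    (#|T| == k) && (u \notin T)) rate k ^+ k * cE sigma (F T))).
  apply: ler_sum => T /andP[/eqP Tk uT].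
  rewrite -{1 2}Tk; apply: (cE_mislabeled hp1 hp2 hq (ltnW n1) ha bal uT) => //.
  by move=> e; apply: indF.
rewrite -mulr_sumr [(_ * L) ^+ _]exprMn -[leRHS]mulrA ler_wpM2l ?exprn_ge0 ?mislabel_rate_ge0//.
rewrite /cE -pE_sum -pEZ; apply: (le_cE hp1 hp2 hq ha) => G.
rewrite /F -mulr_sumr mulrC ler_wpM2r//.
have [NL|_] := boolP (#|revealed u G|%:R <= L); last first.
  by rewrite big1 ?exprn_ge0.
apply: (@le_trans _ _ (#|revealed u G| ^ k)%:R); last first.
  by rewrite natrX lerXn2r// nnegrE.
apply: le_trans (_ : #|[set T : {set 'I_n} | T \subset revealed u G
    & #|T| == k]%SET|%:R <= _); last by rewrite ler_nat card_draws_le.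
rewrite -sum1_card natr_sum /= big_mkcond [leRHS]big_mkcond /=.
apply: ler_sum => T _; rewrite inE andbC.
by case: (#|T| == k) => //; case: (_ \notin _) => //=; case: (_ \subset _).
Qed.

Lemma cE_cst sigma (c : R) : cE sigma (fun=> c) = c.
Proof.
rewrite -[RHS]mulr1 -(pE1 (@sum_pair_weight _ p1 p2 q n a sigma)) -pEZ.
by apply: eq_pE => G; rewrite mulr1.
Qed.

(** Markov's inequality for e^(number of revealed pairs at u), whose factors have mean 1 + a (e -
    1). *)
Lemma cE_many_revealed sigma u (L : R) :
  cE sigma (fun G => (L < #|revealed u G|%:R)%R%:R)
  <= expR ((expR 1 - 1) * tlogn - L).
Proof.
have /andP[a0 a1] := ha.
pose g (s : status) : R := expR (s != censored)%:R.
apply: (@le_trans _ _ (expR (- L) * cE sigma (fun G =>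
    1 * \prod_(w | w \notin [set u]%SET) g (pair_status G u w)))).
  rewrite -pEZ; apply: le_cE => // G; rewrite mul1r.
  rewrite -(big_morph _ (@expRD R) (@expR0 R)) -expRD.
  have -> : \sum_(w | w \notin [set u]%SET) (pair_status G u w != censored)%:R
      = #|revealed u G|%:R :> R.
    rewrite -sum1_card natr_sum big_mkcond [RHS]big_mkcond /=.
    by apply: eq_bigr => w _; rewrite !inE; case: (w != u); case: (_ != _).
  have [LN|_] := ltP L _; last exact: expR_ge0.
  by rewrite -[leLHS](@expR0 R) ler_expR; lra.
rewrite (tilt _ _ _ _ _ (fun _ => g) (set11 u)); last by [].
rewrite cE_cst mul1r addrC expRD ler_wpM2l ?expR_ge0//.
have gE p : \sum_s status_prob a p s * g s = 1 + a * (expR 1 - 1).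
  by rewrite sum_status /g /= expR0; ring.
under eq_bigr do rewrite gE.
have e1 : 0 <= expR 1 - 1 :> R by rewrite subr_ge0 -[leLHS](@expR0 R) ler_expR.
rewrite prodr_const; apply: (@le_trans _ _ ((1 + a * (expR 1 - 1)) ^+ n)).
  apply: ler_weXn2l; first by rewrite lerDl mulr_ge0.
  by rewrite -[X in (_ <= X)%N](card_ord n) max_card.
apply: (@le_trans _ _ (expR (a * (expR 1 - 1)) ^+ n)).
  apply: lerXn2r; rewrite ?nnegrE ?expR_ge0//; last exact: expR_ge1Dx.
  by apply: addr_ge0 => //; exact: mulr_ge0.
rewrite -expRM_natl ler_expR mulrA mulrC ler_wpM2l//.
by rewrite mulrC alphaM// ltnW.
Qed.

Lemma sum_labels_prod (F : bool -> R) :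
  2^-1 ^+ n * \sum_(sigma : labels n) \prod_w F (sigma w) = ((F true + F false) / 2) ^+ n.
Proof.
rewrite -(bigA_distr_bigA (fun _ : 'I_n => F)) prodr_const card_ord.
by rewrite -exprMn big_bool mulrC.
Qed.

(** Exponential Markov at eps and -eps for the two tails. A centred label has exponential moment at
    most e^(x^2 / 2), so the exponent is -eps^2 + eps^2 / 2 per vertex. *)
Lemma unbalanced_tail :
  EE (fun sigma _ => (~~ balanced sigma)%:R)
  <= 2 * expR (- ((gap / 4) ^+ 2 / 2 * n%:R)).
Proof.
set eps := gap / 4.
have eps0 : 0 <= eps by rewrite divr_ge0// gap_ge0.
have eps1 : eps <= 1 by have := gap_le hp1 hp2; rewrite /eps; lra.
pose F (x : R) (b : bool) := expR (x * (b%:R - 2^-1)).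
have prodF x sigma : \prod_w F x (sigma w)
    = expR (x * (\sum_w (sigma w)%:R - n%:R / 2)).
  rewrite -(big_morph _ (@expRD R) (@expR0 R)) -mulr_sumr sumrB.
  by rewrite sumr_const card_ord mulr_natl.
have avgF x : `|x| <= 1 ->
    2^-1 ^+ n * \sum_(sigma : labels n) \prod_w F x (sigma w) <= expR (x ^+ 2 / 2 * n%:R).
  rewrite ler_norml => /andP[x1 x2].
  have FT : F x true <= 1 + x / 2 + x ^+ 2 / 2.
    have := @expR_le_quadratic R (x / 2); rewrite /F /=.
    rewrite (_ : 1 - 2^-1 = 2^-1 :> R); last by field.
    rewrite (_ : 2 * (x / 2) ^+ 2 = x ^+ 2 / 2); last by field.
    by apply; lra.
  have FF : F x false <= 1 - x / 2 + x ^+ 2 / 2.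
    have := @expR_le_quadratic R (- (x / 2)); rewrite /F /= sub0r mulrN.
    rewrite (_ : 2 * (- (x / 2)) ^+ 2 = x ^+ 2 / 2); last by field.
    by apply; lra.
  rewrite sum_labels_prod.
  apply: (@le_trans _ _ (expR (x ^+ 2 / 2) ^+ n)); last first.
    by rewrite -expRM_natl mulrC.
  have F0 b : 0 <= F x b by exact: expR_ge0.
  rewrite lerXn2r ?nnegrE ?expR_ge0 ?divr_ge0 ?addr_ge0//.
  have := expR_ge1Dx (x ^+ 2 / 2); lra.
rewrite /EE; under eq_bigr do rewrite cE_cst.
apply: (@le_trans _ _ (2^-1 ^+ n * \sum_(sigma : labels n) (expR (- (eps ^+ 2 * n%:R)) *
    (\prod_w F eps (sigma w) + \prod_w F (- eps) (sigma w))))).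
  rewrite ler_wpM2l ?exprn_ge0 ?invr_ge0//; apply: ler_sum => sigma _.
  rewrite mulrDr !prodF -!expRD /balanced -ltNge.
  set S := _ - n%:R / 2; rewrite -/eps.
  have [SE|_] /= := ltP _ `|S|; last by rewrite addr_ge0 ?expR_ge0.
  have expR_ge (x : R) : 0 <= x -> 1 <= expR x.
    by move=> x0; rewrite -[leLHS](@expR0 R) ler_expR.
  have [S0|S0] := lerP 0 S.
    rewrite ger0_norm// in SE.
    rewrite -[leLHS]addr0 lerD ?expR_ge0// expR_ge//.
    by have := ler_wpM2l eps0 (ltW SE); lra.
  rewrite ltr0_norm// in SE.
  rewrite -[leLHS]add0r lerD ?expR_ge0// expR_ge//.
  by have := ler_wpM2l eps0 (ltW SE); lra.
rewrite -mulr_sumr big_split /= mulrCA mulrDr.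
have h1 : `|eps| <= 1 by rewrite ger0_norm.
have h2 : `|- eps| <= 1 by rewrite normrN ger0_norm.
have := lerD (avgF _ h1) (avgF _ h2); rewrite sqrrN.
move/(ler_wpM2l (expR_ge0 (- (eps ^+ 2 * n%:R)))) => /le_trans; apply.
rewrite -mulr2n -[_ *+ 2]mulr_natl mulrCA -expRD ler_wpM2l// ler_expR.
by rewrite le_eqVlt; apply/orP; left; apply/eqP; field.
Qed.

Definition genie_err u sigma G : bool := (0 <= Gamma G u sigma) != sigma u.

(* Flipping the label of u multiplies the mass by e^Gamma or e^(-Gamma), and it
   turns a success of the genie at u into a failure. *)
Lemma near_tie u (x : R) :
  EE (fun sigma G => (`|Gamma G u sigma| <= x)%R%:R)
  <= (1 + expR x) * EE (fun sigma G => (genie_err u sigma G)%:R).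
Proof.
rewrite /EE mulrCA ler_wpM2l ?exprn_ge0 ?invr_ge0//.
pose flip sigma : labels n := upd sigma u (~~ sigma u).
have flipK : involutive flip.
  move=> sigma; apply/ffunP => v; rewrite !ffunE eqxx negbK.
  by case: eqP => [->|].
have updK sigma b : sigma u = b -> sigma = upd sigma u b.
  by move=> <-; apply/ffunP => v; rewrite ffunE; case: eqP => // ->.
have err_flip sigma G : genie_err u (flip sigma) G = ~~ genie_err u sigma G.
  rewrite /genie_err /flip Gamma_upd ffunE eqxx.
  by case: (sigma u); case: (0 <= _).
have cmass_ge0 sigma G : 0 <= cmass sigma G.
  by apply: weight_ge0 => e s; exact: pair_weight_ge0.
have cmass_le sigma G : `|Gamma G u sigma| <= x ->
    cmass sigma G <= expR x * cmass (flip sigma) G.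
  rewrite ler_norml => /andP[Gx1 Gx2].
  have := cmass_flip hp1 hp2 hq n1 a sigma G u.
  case su: (sigma u) => flipE;
    rewrite /flip su [X in cmass X _ <= _](updK _ _ su) /= flipE.
    by rewrite ler_wpM2r// ler_expR.
  rewrite mulrA -expRD ler_peMl//.
  by rewrite -[leLHS](@expR0 R) ler_expR; lra.
apply: (@le_trans _ _ (\sum_sigma \sum_G (cmass sigma G * (genie_err u sigma G)%:R
    + expR x * (cmass (flip sigma) G * (genie_err u (flip sigma) G)%:R)))).
  apply: ler_sum => sigma _; apply: ler_sum => G _; rewrite -/(cmass sigma G).
  have [Gx|_] := leP _ x; last first.
    by rewrite mulr0 addr_ge0 ?mulr_ge0 ?expR_ge0.
  rewrite err_flip mulr1; case: (genie_err u sigma G) => /=.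
    by rewrite !mulr0 addr0 mulr1.
  by rewrite mulr0 add0r mulr1 cmass_le.
under eq_bigr do rewrite big_split.
rewrite big_split /= mulrDl mul1r lerD//.
under eq_bigr do rewrite -mulr_sumr.
rewrite -mulr_sumr ler_wpM2l ?expR_ge0//.
by rewrite [leRHS](reindex_inj (inv_inj flipK)).
Qed.

(** A disagreement falls into one of four events: a near tie with at least one revealed mislabeled
    neighbour (A1), at least K of them (A2), too many revealed pairs (A3), unbalanced labels (A4).
    In A1 the tie depends only on the pairs at u, so the mislabeling contributes the factor
    [rate 1 * L], and [near_tie] compares the tie with the genie error. *)
Lemma two_step_vs_genie u K (L : R) : 0 <= L ->
  EE (fun sigma G =>
        ((0 <= Gamma G u (hat G)) != (0 <= Gamma G u sigma))%R%:R)
  <= rate 1 * L * (1 + expR (2 * llr_bound * K%:R))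
       * EE (fun sigma G => (genie_err u sigma G)%:R)
     + ((rate K * L) ^+ K + expR ((expR 1 - 1) * tlogn - L)
     + 2 * expR (- ((gap / 4) ^+ 2 / 2 * n%:R))).
Proof.
move=> L0; have l0 := llr_bound_ge0.
pose few G := #|revealed u G|%:R <= L.
pose MR sigma G := #|revealed_mislabeled sigma u G|.
pose tie sigma G := `|Gamma G u sigma| <= 2 * llr_bound * K%:R.
pose A1 sigma G : R := (balanced sigma)%:R *
  ((tie sigma G)%:R * (few G && (1 <= MR sigma G)%N)%:R).
pose A2 sigma G : R := (balanced sigma)%:R *
  (1 * (few G && (K <= MR sigma G)%N)%:R).
pose A3 (sigma : labels n) G : R := (L < #|revealed u G|%:R)%R%:R.
pose A4 sigma (G : observation n) : R := (~~ balanced sigma)%:R.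
apply: (@le_trans _ _ (EE (fun sigma G =>
    A1 sigma G + (A2 sigma G + A3 sigma G + A4 sigma G)))).
  apply: le_EE => // sigma G.
  have A10 : 0 <= A1 sigma G by rewrite !mulr_ge0.
  have A20 : 0 <= A2 sigma G by rewrite !mulr_ge0.
  have A30 : 0 <= A3 sigma G by [].
  case: (boolP (_ != _)) => [/disagreement[M0 GM]|_]; last by rewrite !addr_ge0.
  rewrite {1}/A4; case: (boolP (balanced sigma)) => /= [bal|_]; last first.
    by rewrite -[leLHS]add0r addrA lerD ?addr_ge0.
  rewrite addr0; have [NL|NL] := leP #|revealed u G|%:R L; last first.
    by rewrite {1}/A3 NL addrA -[leLHS]add0r lerD ?addr_ge0.
  have [KM|KM] := leqP K (MR sigma G).
    rewrite {1}/A2 bal /few NL KM /= !mulr1 addrCA -[leLHS]addr0.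
    by rewrite lerD ?addr_ge0.
  rewrite {1}/A1 bal /few NL /MR M0 /= mulr1 mul1r.
  suff -> : tie sigma G by rewrite -[leLHS]addr0 lerD ?addr_ge0.
  apply: (le_trans GM); rewrite ler_wpM2l ?mulr_ge0// ler_nat ltnW//.
have indtie sigma (e : upair n) : u \notin val e ->
    indep e (fun G : {ffun upair n -> status} => (tie sigma G)%:R : R).
  exact: (indep_Gamma p1 p2 q sigma (fun y => (`|y| <= _)%R%:R)).
have bound k sigma (f : observation n -> R) : (forall G, 0 <= f G) ->
    (forall e : upair n, u \notin val e -> indep e f) ->
    cE sigma (fun G => (balanced sigma)%:R *
      (f G * (few G && (k <= MR sigma G)%N)%:R)) <= (rate k * L) ^+ k * cE sigma f.
  move=> f0 indf; rewrite /cE pEZ; case: (boolP (balanced sigma)) => bal.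
    by rewrite mul1r; exact: cE_revealed_mislabeled.
  rewrite mul0r mulr_ge0 ?exprn_ge0 ?mulr_ge0 ?mislabel_rate_ge0//.
  exact: cE_ge0.
have EEc (c : R) : EE (fun (_ : labels n) _ => c) = c.
  transitivity (c * EE (fun (_ : labels n) _ => 1)); last by rewrite EE1 mulr1.
  rewrite -EEZ /EE; congr (_ * _); apply: eq_bigr => sigma _.
  by apply: eq_pE => G; rewrite mulr1.
rewrite !EED; apply: lerD; last apply: lerD; last exact: unbalanced_tail.
- apply: (@le_trans _ _ (rate 1 * L * EE (fun sigma G => (tie sigma G)%:R))).
    rewrite -EEZ /EE ler_wpM2l ?exprn_ge0 ?invr_ge0//.
    apply: ler_sum => sigma _; rewrite [leRHS]pEZ -[rate 1 * L]expr1.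
    by apply: bound => // e; exact: indtie.
  rewrite -[leRHS]mulrA ler_wpM2l ?mulr_ge0 ?mislabel_rate_ge0//.
  exact: near_tie.
- apply: lerD.
    rewrite -[leRHS]EEc /EE ler_wpM2l ?exprn_ge0 ?invr_ge0//.
    apply: ler_sum => sigma _; rewrite cE_cst -[leRHS]mulr1.
    rewrite -[X in _ * X](cE_cst sigma 1); exact: bound.
  rewrite -[leRHS]EEc /EE ler_wpM2l ?exprn_ge0 ?invr_ge0//.
  by apply: ler_sum => sigma _; rewrite cE_cst; exact: cE_many_revealed.
Qed.

End Comparison.

(** * Chernoff bounds for the genie *)

Section Affinity.
Variables (R : realType) (p1 p2 q : R).
Hypotheses (hp1 : 0 < p1 < 1) (hp2 : 0 < p2 < 1) (hq : 0 < q < 1).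

Local Notation pair_prob := (pair_prob p1 p2 q).
Local Notation llr := (llr p1 p2 q).

(** Chernoff affinity between the laws of a revealed pair under the two labels of one end; at y =
    1/2 it is the Bhattacharyya coefficient. *)
Definition affinity (b b' : bool) (y : R) : R :=
  \sum_(e : bool) bern (pair_prob b b') e `^ (1 - y) * bern (pair_prob (~~ b) b') e `^ y.

Definition lsign (b : bool) : R := if b then 1 else -1.

Lemma normr_lsign b : `|lsign b| = 1.
Proof. by case: b; rewrite /= ?normrN1 ?normr1. Qed.

Let bern_ep_gt0 b b' e : 0 < bern (pair_prob b b') e.
Proof. by rewrite bern_gt0 ?pair_prob_bounds. Qed.

(** The tilt is the y-th power of the likelihood ratio of the wrong label to the right one; a
    censored pair carries no information and keeps its weight 1 - a. *)
Lemma tilted_status_sum a b b' y :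
  \sum_s status_prob a (pair_prob b b') s * expR (- (y * lsign b) * llr b' s)
  = 1 - a + a * affinity b b' y.
Proof.
have key e : bern (pair_prob b b') e * expR (- (y * lsign b) * llr b' (Some e))
    = bern (pair_prob b b') e `^ (1 - y) * bern (pair_prob (~~ b) b') e `^ y.
  rewrite /powR !gt_eqF// -expRD -[X in X * _]lnK ?posrE// -expRD.
  rewrite /llr ln_div ?posrE//; congr expR.
  by case: b => /=; ring.
have -> : affinity b b' y =
    bern (pair_prob b b') true * expR (- (y * lsign b) * llr b' (Some true))
    + bern (pair_prob b b') false * expR (- (y * lsign b) * llr b' (Some false)).
  by rewrite !key /affinity big_bool.
rewrite sum_status /present /absent /censored /status_prob.
by rewrite (_ : llr b' None = 0)// mulr0 expR0 /bern; ring.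
Qed.

Lemma affinity_ge0 b b' y : 0 <= affinity b b' y.
Proof. by apply: sumr_ge0 => e _; rewrite mulr_ge0 ?powR_ge0. Qed.

(** The entries of [c1] and [c2] are the pair laws for the labels + and - of the end. Exchanging the
    two labels exchanges x and 1 - x, so both types of error share one exponent. *)
Lemma chernoff_affinity b x :
  Defs.chernoff p1 p2 q x
  = affinity b true (if b then 1 - x else x)
    + affinity b false (if b then 1 - x else x).
Proof.
rewrite /Defs.chernoff /affinity !big_ord_recl big_ord0 !big_bool /=.
rewrite !(tnth_nth 0) /=.
by case: b => /=; rewrite ?subKr; ring.
Qed.

(** Strict inequality between geometric and arithmetic means, summed over the two edge states. *)
Lemma affinity_half_lt1 b b' : p1 != q -> p2 != q -> affinity b b' 2^-1 < 1.
Proof.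
move=> p1q p2q.
have half : 1 - 2^-1 = 2^-1 :> R by field.
have neq : pair_prob b b' != pair_prob (~~ b) b'.
  by case: b; case: b'; rewrite //= eq_sym.
have amgm (x y : R) : 0 < x -> 0 < y -> x != y ->
    x `^ 2^-1 * y `^ 2^-1 < (x + y) / 2.
  move=> x0 y0 xy; rewrite !powR12_sqrt ?ltW//.
  have sxy : Num.sqrt x != Num.sqrt y.
    apply: contra xy => /eqP/(congr1 (fun z => z ^+ 2)).
    by rewrite !sqr_sqrtr ?ltW// => ->.
  have : 0 < (Num.sqrt x - Num.sqrt y) ^+ 2 by rewrite exprn_even_gt0//= subr_eq0.
  rewrite sqrrB !sqr_sqrtr ?ltW//; lra.
rewrite /affinity big_bool half.
have e1 := amgm _ _ (bern_ep_gt0 b b' true) (bern_ep_gt0 (~~ b) b' true) neq.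
have neq' : bern (pair_prob b b') false != bern (pair_prob (~~ b) b') false.
  by apply: contra neq => /eqP /= /(congr1 (fun z => 1 - z)); rewrite !subKr => ->.
have e2 := amgm _ _ (bern_ep_gt0 b b' false) (bern_ep_gt0 (~~ b) b' false) neq'.
by apply: lt_le_trans (ltrD e1 e2) _; rewrite /bern; lra.
Qed.

(** Supplies the constant for [genie_err_pair]: a decay that is uniform in all the labels. *)
Lemma affinity_gap : p1 != q -> p2 != q ->
  exists2 kappa : R, 0 < kappa & forall b b', affinity b b' 2^-1 <= 1 - kappa.
Proof.
move=> p1q p2q; pose A (x : bool * bool) := affinity x.1 x.2 2^-1.
exists (1 - \big[Num.max/0]_x A x) => [|b b']; last first.
  by rewrite subKr (le_bigmax _ A (b, b')).
by rewrite subr_gt0; apply: bigmax_lt => // -[b b'] _; exact: affinity_half_lt1.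
Qed.

Variables (t : R) (n : nat).
Hypotheses (n1 : (1 < n)%N) (ha : 0 <= alpha t n <= 1).
Implicit Types (sigma : labels n) (G : observation n) (u v w : 'I_n).

Local Notation a := (alpha t n).
Local Notation cE := (cE p1 p2 q a).
Local Notation EE := (EE p1 p2 q a).
Local Notation Gamma := (Gamma p1 p2 q).
Local Notation tlogn := (t * ln n%:R).
Local Notation C0 := (llr_bound p1 p2 q).
Local Notation genie_err := (genie_err p1 p2 q).

Lemma tilted_mass_ge0 b b' y : 0 <= 1 - a + a * affinity b b' y.
Proof.
have /andP[a0 a1] := ha; apply: addr_ge0; first by rewrite subr_ge0.
by apply: mulr_ge0 => //; exact: affinity_ge0.
Qed.

(** A Chernoff bound that gives up the pairs between v and U. Each of them moves Gamma by at most
    [C0], and in return f may depend on them. *)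
Lemma cE_genie_err sigma v (U : {set 'I_n}) y (f : observation n -> R) :
  v \in U -> 0 <= y -> (forall G, 0 <= f G) ->
  (forall (e : upair n) w, w \notin U -> val e = [set v; w]%SET -> indep e f) ->
  cE sigma (fun G => f G * (genie_err v sigma G)%:R)
  <= expR (y * C0 * #|U|%:R) * (cE sigma f *
     \prod_(w | w \notin U) (1 - a + a * affinity (sigma v) (sigma w) y)).
Proof.
move=> vU y0 f0 indf; set s := lsign (sigma v).
rewrite [X in cE _ f * X](_ : _ = \prod_(w | w \notin U)
    \sum_st status_prob a (pair_prob (sigma v) (sigma w)) st *
      expR (- (y * s) * llr (sigma w) st)); last first.
  by apply: eq_bigr => w _; rewrite tilted_status_sum.
rewrite -(tilt _ _ _ _ _ (fun w st => expR (- (y * s) * llr (sigma w) st)) vU)//.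
rewrite -pEZ; apply: le_cE => // G; rewrite mulrCA ler_wpM2l//.
rewrite -(big_morph _ (@expRD R) (@expR0 R)) -expRD.
rewrite /genie_err; case: eqP => [_|neq]; first exact: expR_ge0.
have sG : s * Gamma G v sigma <= 0.
  move: neq; rewrite /s; case: (sigma v); case: leP => //=; lra.
rewrite -[leLHS](@expR0 R) ler_expR -mulr_sumr.
have GU : `|Gamma G v sigma - \sum_(w | w \notin U) llr (sigma w) (pair_status G v w)|
    <= C0 * #|U|%:R.
  rewrite GammaE (bigID (mem U)) /= [X in _ + X - _](_ : _ =
    \sum_(w | w \notin U) llr (sigma w) (pair_status G v w)); last first.
    by apply: eq_bigl => w; rewrite andb_idl//; apply: contraNneq => ->.
  rewrite addrK (le_trans (ler_norm_sum _ _ _))// -sum1_card natr_sum mulr_sumr.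
  rewrite big_mkcond [leRHS]big_mkcond /=; apply: ler_sum => w _.
  rewrite mulr1; case: (w \in U); rewrite ?andbF//.
  by case: (w != v); rewrite ?llr_le ?llr_bound_ge0.
have sD : - (s * (\sum_(w | w \notin U) llr (sigma w) (pair_status G v w)
    - Gamma G v sigma)) >= - (C0 * #|U|%:R).
  rewrite lerN2 (le_trans (ler_norm _))// normrM normr_lsign mul1r.
  by rewrite distrC.
have := ler_wpM2l y0 sG; have := ler_wpM2l y0 sD; lra.
Qed.

Lemma alphaMB (kappa : R) k : 0 <= kappa ->
  expR (- (a * kappa)) ^+ (n - k) <= expR (k%:R * kappa) * expR (- (kappa * tlogn)).
Proof.
move=> k0; have /andP[a0 a1] := ha.
rewrite -expRM_natl -expRD ler_expR -(alphaM _ (ltnW n1)).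
have nk : n%:R <= (n - k)%:R + k%:R :> R by rewrite -natrD ler_nat addnC -leq_subLR.
have := ler_wpM2l (mulr_ge0 a0 k0) nk.
have := ler_wpM2r (mulr_ge0 k0 (ler0n R k)) a1.
lra.
Qed.

Lemma prod_notin_const (U : {set 'I_n}) (c : R) :
  \prod_(w | w \notin U) c = c ^+ (n - #|U|).
Proof.
rewrite (eq_bigl (fun w => w \in ~: U)%SET) ?prodr_const => [|w]; last first.
  by rewrite inE.
congr (_ ^+ _); rewrite -[X in (X - _)%N](card_ord n) -(cardsC U) addKn.
by apply: eq_card.
Qed.

(** The errors at u and v share only the pair {u, v}. Giving it up at v, with U = {u, v}, makes the
    error at u an admissible weight. *)
Lemma genie_err_pair (kappa : R) u v : u != v -> 0 <= kappa ->
  (forall b b', affinity b b' 2^-1 <= 1 - kappa) ->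
  EE (fun sigma G => (genie_err u sigma G)%:R * (genie_err v sigma G)%:R)
  <= expR (C0 + 2 * kappa) * expR (- (kappa * tlogn))
     * EE (fun sigma G => (genie_err u sigma G)%:R).
Proof.
move=> uv k0 aff; rewrite -EEZ /EE ler_wpM2l ?exprn_ge0 ?invr_ge0//.
apply: ler_sum => sigma _; have /andP[a0 a1] := ha.
set U := [set u; v]%SET.
have cU : #|U| = 2 by rewrite cards2 uv.
have vU : v \in U by rewrite !inE eqxx orbT.
have uU : u \in U by rewrite !inE eqxx.
apply: le_trans (@cE_genie_err sigma v U 2^-1 _ vU _ _ _) _ => //.
  move=> e w wU evw; apply: (indep_Gamma p1 p2 q sigma
    (fun z => ((0 <= z)%R != sigma u)%:R)).
  rewrite evw !inE negb_or uv /=.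
  by apply: contraNneq wU => <-.
rewrite [leRHS]pEZ mulrCA [leRHS]mulrC ler_wpM2l ?cE_ge0//.
rewrite (_ : 2^-1 * C0 * #|U|%:R = C0); last by rewrite cU; field.
rewrite [expR (C0 + _)]expRD -[leRHS]mulrA ler_wpM2l ?expR_ge0//.
apply: le_trans (alphaMB 2 k0).
apply: (@le_trans _ _ (\prod_(w | w \notin U) expR (- (a * kappa)))).
  apply: ler_prod => w _; rewrite tilted_mass_ge0 /=.
  apply: le_trans (expR_ge1Dx _).
  by have := ler_wpM2l a0 (aff (sigma v) (sigma w)); lra.
by rewrite prod_notin_const cU.
Qed.

(** The exponent y depends on the label of u so that both labels lead to [chernoff] at the same x.
    Averaging a factor z over the label of another vertex gives 1 - a S, hence about e^(-S t log n)
    over all vertices. *)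
Lemma genie_err_chernoff u x : 0 <= x <= 1 -> Defs.chernoff p1 p2 q x <= 2 ->
  EE (fun sigma G => (genie_err u sigma G)%:R)
  <= 2 * expR (C0 + 1) * expR (- ((1 - 2^-1 * Defs.chernoff p1 p2 q x) * tlogn)).
Proof.
move=> /andP[x0 x1] ch2; have /andP[a0 a1] := ha.
set S := 1 - 2^-1 * _; have S0 : 0 <= S by rewrite /S; lra.
have S1 : S <= 1.
  by rewrite /S (chernoff_affinity true) gerBl mulr_ge0 ?addr_ge0 ?affinity_ge0.
pose y (b : bool) : R := if b then 1 - x else x.
have y01 b : 0 <= y b <= 1 by rewrite /y; case: b; lra.
pose z b b' := 1 - a + a * affinity b b' (y b).
have z0 b b' : 0 <= z b b' by exact: tilted_mass_ge0.
pose P b sigma := \prod_(w | w \notin [set u]%SET) z b (sigma w).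
have P0 b sigma : 0 <= P b sigma by exact: prodr_ge0.
have cE_le sigma : cE sigma (fun G => (genie_err u sigma G)%:R)
    <= expR C0 * (P true sigma + P false sigma).
  apply: (@le_trans _ _ (cE sigma (fun G => 1 * (genie_err u sigma G)%:R))).
    by apply: le_cE => // G; rewrite mul1r.
  have /andP[yu0 yu1] := y01 (sigma u).
  apply: le_trans (@cE_genie_err sigma u [set u]%SET (y (sigma u)) _ _ _ _ _) _ => //.
    by rewrite set11.
  rewrite cE_cst mul1r cards1 mulr1 ler_pM ?expR_ge0//.
  - exact: P0.
  - by rewrite ler_expR ler_piMl ?llr_bound_ge0.
  - rewrite -/(P (sigma u) sigma); case: (sigma u).
      by rewrite lerDl.
    by rewrite lerDr.
have avgP b : 2^-1 ^+ n * \sum_sigma P b sigma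
    <= expR 1 * expR (- (S * tlogn)).
  (* The factor 1 at w = u lets the sum over all labels factorise. *)
  pose F w b' := if w \notin [set u]%SET then z b b' else 1.
  have -> : \sum_sigma P b sigma = \prod_w \sum_b' F w b'.
    rewrite bigA_distr_bigA; apply: eq_bigr => sigma _.
    by rewrite /P big_mkcond.
  rewrite -[X in _ ^+ X](card_ord n) -prodr_const -big_split /=.
  apply: (@le_trans _ _ (\prod_(w < n | w \notin [set u]%SET) expR (- (a * S)))).
    rewrite [leRHS]big_mkcond; apply: ler_prod => w _.
    rewrite big_bool /F; case: ifP => _; last by rewrite mulVf ?ler01 ?lexx.
    rewrite mulr_ge0 ?invr_ge0 ?(addr_ge0 (z0 _ _) (z0 _ _))//=.
    apply: le_trans (expR_ge1Dx _).
    by rewrite /z /S (chernoff_affinity b) -/(y b); lra.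
  rewrite prod_notin_const cards1.
  apply: (le_trans (alphaMB 1 S0)); rewrite mul1r.
  by rewrite ler_wpM2r ?expR_ge0// ler_expR.
apply: (@le_trans _ _ (2^-1 ^+ n * \sum_sigma (expR C0 * (P true sigma + P false sigma)))).
  by rewrite ler_wpM2l ?exprn_ge0 ?invr_ge0//; apply: ler_sum.
rewrite -mulr_sumr big_split /= mulrCA mulrDr expRD.
have := lerD (avgP true) (avgP false).
move/(ler_wpM2l (expR_ge0 C0)) => /le_trans; apply.
by rewrite le_eqVlt; apply/orP; left; apply/eqP; ring.
Qed.

End Affinity.

(** * Error rates for fixed n *)

Section ErrorRates.
Variables (R : realType) (p1 p2 q t : R) (n : nat).
Hypotheses (hp1 : 0 < p1 < 1) (hp2 : 0 < p2 < 1) (hq : 0 < q < 1).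
Hypotheses (n1 : (1 < n)%N) (ha : 0 < alpha t n < 1).
Implicit Types (sigma : labels n) (G : observation n) (u v w : 'I_n).

Local Notation EE := (EE p1 p2 q (alpha t n)).
Local Notation Gamma := (Gamma p1 p2 q).
Local Notation genie_err := (genie_err p1 p2 q).
Local Notation hat := (fun G => oriented p1 p2 (sigma_deg p1 p2 q t G)).

Let ha' : 0 <= alpha t n <= 1.
Proof. by have /andP[/ltW-> /ltW->] := ha. Qed.

Definition two_step_deg (w : sample n) : labels n :=
  two_step p1 p2 q (obs w) (oriented p1 p2 (sigma_deg p1 p2 q t (obs w))).

Definition split_err sigma G u : R :=
  ((0 <= Gamma G u (hat G)) != (0 <= Gamma G u sigma))%R%:R.

Definition avg (f : 'I_n -> R) : R := n%:R^-1 * \sum_u f u.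

Definition genie_rate : R := avg (fun u => EE (fun sigma G => (genie_err u sigma G)%:R)).

Let n0 : 0 < n%:R :> R.
Proof. by rewrite ltr0n ltnW. Qed.

Lemma avg_cst c : avg (fun=> c) = c.
Proof. by rewrite /avg sumr_const card_ord -[c *+ n]mulr_natl mulKf// gt_eqF. Qed.

Lemma le_avg f g : (forall u, f u <= g u) -> avg f <= avg g.
Proof. by move=> fg; rewrite /avg ler_wpM2l ?invr_ge0//; apply: ler_sum. Qed.

Lemma avg_ge0 f : (forall u, 0 <= f u) -> 0 <= avg f.
Proof. by move=> f0; rewrite /avg mulr_ge0 ?invr_ge0//; apply: sumr_ge0. Qed.

Lemma EE_avg (f : 'I_n -> labels n -> observation n -> R) :
  EE (fun sigma G => avg (fun u => f u sigma G)) = avg (fun u => EE (f u)).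
Proof. by rewrite /avg EEZ EE_sum. Qed.

(** Every vertex is wrong under exactly one of the two global signs, so the two mismatch rates add
    up to 1. *)
Lemma min_mismatch (hat sigma : labels n) :
  Num.min (mismatch R true hat sigma) (mismatch R false hat sigma)
  = let m := avg (fun u => (hat u != sigma u)%:R) in Num.min m (1 - m).
Proof.
move=> /=; congr Num.min.
  by congr (_ * _); apply: eq_bigr => u _; rewrite ffunE.
rewrite -[X in X - _](avg_cst 1) /mismatch /avg -mulrBr -sumrB; congr (_ * _).
apply: eq_bigr => u _; rewrite ffunE.
by case: (hat u); case: (sigma u); rewrite /= ?subrr ?subr0.
Qed.

Lemma Err_two_step : Err p1 p2 q t two_step_deg = EE (fun sigma G =>
  let m := avg (fun u => ((0 <= Gamma G u (hat G))%R != sigma u)%:R) in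
  Num.min m (1 - m)).
Proof.
rewrite /Err -(Ex_sigma0_obs p1 p2 q t); congr (Ex _ _ _ _ _).
apply/funext => w; rewrite min_mismatch /=.
by congr (let m := avg _ in Num.min m (1 - m)); apply/funext => u; rewrite ffunE.
Qed.

Lemma Err_best : Err p1 p2 q t (@sigma_best R p1 p2 q t n)
  = EE (fun sigma G =>
     let m := avg (fun u => (genie_err u sigma G)%:R) in Num.min m (1 - m)).
Proof.
rewrite /Err -(Ex_sigma0_obs p1 p2 q t); congr (Ex _ _ _ _ _).
apply/funext => w; rewrite min_mismatch sigma_bestE//=.
by congr (let m := avg _ in Num.min m (1 - m)); apply/funext => u; rewrite ffunE.
Qed.

Lemma min_lipschitz (x y : R) :
  `|Num.min x (1 - x) - Num.min y (1 - y)| <= `|x - y|.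
Proof.
rewrite !minElt; case: ltP => ?; case: ltP => ?; rewrite ler_norml;
  apply/andP; split; case: (ger0P (x - y)) => ?; lra.
Qed.

Lemma Err_dist :
  `|Err p1 p2 q t two_step_deg - Err p1 p2 q t (@sigma_best R p1 p2 q t n)|
  <= avg (fun u => EE (fun sigma G => split_err sigma G u)).
Proof.
rewrite Err_two_step Err_best -EE_avg.
rewrite -[X in _ - X]mul1r -mulNr -EEZ -EED.
have absEE F : `|EE F| <= EE (fun sigma G => `|F sigma G|).
  rewrite ler_norml; apply/andP; split.
    rewrite -mulN1r -EEZ; apply: le_EE => // sigma G.
    by rewrite mulN1r lerNl -normrN ler_norm.
  by apply: le_EE => // sigma G; exact: ler_norm.
apply: (le_trans (absEE _)); apply: le_EE => // sigma G.
rewrite mulN1r; apply: le_trans (min_lipschitz _ _) _.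
rewrite /avg -mulrBr -sumrB normrM [`|n%:R^-1|]ger0_norm ?invr_ge0 ?(ltW n0)//.
rewrite ler_wpM2l ?invr_ge0 ?(ltW n0)//; apply: (le_trans (ler_norm_sum _ _ _)).
apply: ler_sum => u _; rewrite /split_err /genie_err.
by case: (0 <= _)%R; case: (0 <= _)%R; case: (sigma u);
  rewrite /= ?subrr ?subr0 ?sub0r ?normrN ?normr1 ?normr0.
Qed.

(** The minimum over the sign costs little, since m <= min(m, 1 - m) + 2 m^2. The mean of m^2 is an
    average over pairs of vertices: the diagonal gives 1/n and the other pairs are bounded by
    [genie_err_pair]. *)
Lemma genie_rate_le kappa : 0 <= kappa ->
  (forall b b', affinity p1 p2 q b b' 2^-1 <= 1 - kappa) ->
  genie_rate <= Err p1 p2 q t (@sigma_best R p1 p2 q t n)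
    + 2 * (n%:R^-1 + expR (llr_bound p1 p2 q + 2 * kappa)
                     * expR (- (kappa * (t * ln n%:R)))) * genie_rate.
Proof.
move=> k0 aff; set rho := expR _ * _.
have rho0 : 0 <= rho by rewrite mulr_ge0 ?expR_ge0.
pose e u := EE (fun sigma G => (genie_err u sigma G)%:R).
have e0 u : 0 <= e u by apply: EE_ge0.
apply: (@le_trans _ _ (EE (fun sigma G =>
    (let m := avg (fun u => (genie_err u sigma G)%:R) in Num.min m (1 - m))
    + 2 * avg (fun u => avg (fun v =>
        (genie_err u sigma G)%:R * (genie_err v sigma G)%:R))))).
  rewrite /genie_rate -EE_avg; apply: le_EE => // sigma G.
  set m := avg _ => /=.
  have -> : avg (fun u => avg (fun v =>
      (genie_err u sigma G)%:R * (genie_err v sigma G)%:R)) = m * m.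
    rewrite /m /avg; under eq_bigr do rewrite -mulr_sumr mulrCA.
    by rewrite -mulr_suml mulrA.
  rewrite minElt; case: ltP => _; first by rewrite lerDl mulr_ge0// -expr2 sqr_ge0.
  (* When the minimum is 1 - m, the claim is 2 m^2 - 2 m + 1 >= 0. *)
  by have := sqr_ge0 (2 * m - 1); rewrite expr2; nra.
rewrite EED -Err_best EEZ -mulrA lerD2l ler_wpM2l//.
rewrite EE_avg /genie_rate -/e; under [X in avg X]eq_fun do rewrite EE_avg.
rewrite [leRHS](_ : _ = avg (fun u => (n%:R^-1 + rho) * e u)); last first.
  by rewrite /avg mulrCA; congr (_ * _); rewrite mulr_sumr.
apply: le_avg => u; rewrite /avg (bigD1 u)//= mulrDr mulrDl lerD//.
  rewrite ler_wpM2l ?invr_ge0 ?(ltW n0)//; apply: le_EE => // sigma G.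
  by case: (genie_err u sigma G); rewrite /= ?mulr1 ?mulr0.
rewrite ler_pdivrMl// [leRHS](_ : _ = \sum_(v < n) rho * e u); last first.
  by rewrite sumr_const card_ord mulr_natl.
rewrite [leLHS]big_mkcond; apply: ler_sum => v _.
case: ifPn => [vu|_]; last by rewrite mulr_ge0.
by apply: genie_err_pair => //; rewrite eq_sym.
Qed.

Lemma recovery_PrE : recovery_Pr p1 p2 q t two_step_deg = EE (fun sigma G =>
  [exists s : bool, [ffun u => 0 <= Gamma G u (hat G)] == signed s sigma]%:R).
Proof. by rewrite /recovery_Pr Pr_Ex -(Ex_sigma0_obs p1 p2 q t). Qed.

(** Failure under both signs implies failure under +, so at some vertex the genie errs or the two
    estimators differ; then a union bound. *)
Lemma recovery_failure :
  1 - recovery_Pr p1 p2 q t two_step_deg <=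
  n%:R * (genie_rate + avg (fun u => EE (fun sigma G => split_err sigma G u))).
Proof.
rewrite recovery_PrE -[X in X - _](EE1 p1 p2 q n (alpha t n)).
rewrite -[X in _ - X]mul1r -mulNr -EEZ -EED mulrDr /genie_rate /avg.
rewrite !mulVKf ?gt_eqF// -!EE_sum -EED; apply: le_EE => // sigma G.
set E := [exists s, _].
have [e|/negP ne] := boolP E.
  by rewrite mulr1 subrr; apply: addr_ge0; apply: sumr_ge0.
have [u Xu] : exists u, (0 <= Gamma G u (hat G)) != sigma u.
  apply/existsP; apply: contrapT => /negP; rewrite negb_exists => /forallP eqX.
  apply: ne; apply/existsP; exists true; apply/eqP/ffunP => u; rewrite !ffunE.
  by apply/eqP; have := eqX u; rewrite negbK.
rewrite mulr0 addr0 -big_split (bigD1 u)//= -[leLHS]addr0 lerD//; last first.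
  by apply: sumr_ge0 => v _; apply: addr_ge0; rewrite /split_err.
move: Xu; rewrite /split_err /genie_err.
by case: (0 <= Gamma G u (hat G))%R; case: (0 <= Gamma G u sigma)%R; case: (sigma u);
  rewrite //= ?addr0 ?add0r.
Qed.

Lemma recovery_Pr_le1 : recovery_Pr p1 p2 q t two_step_deg <= 1.
Proof.
rewrite recovery_PrE -[leRHS](EE1 p1 p2 q n (alpha t n)); apply: le_EE => // sigma G.
by case: [exists s, _].
Qed.

End ErrorRates.

(** * Asymptotics *)

Section Asymptotics.
Variable R : realType.
Implicit Types (c C eps t x : R) (n : nat).

Lemma expR_lnn n : (0 < n)%N -> expR (ln n%:R) = n%:R :> R.
Proof. by move=> n0; rewrite lnK// posrE ltr0n. Qed.

Lemma near_lt_lnn x : \forall n \near \oo, x < ln n%:R :> R.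
Proof.
near=> n; rewrite -ltr_expR expR_lnn//; last by near: n; exact: nbhs_infty_gt.
by near: n; exact: nbhs_infty_gtr.
Unshelve. all: by end_near. Qed.

Lemma near_expR_lnn_le c C eps : 0 < c -> 0 < eps ->
  \forall n \near \oo, C * expR (- (c * ln n%:R)) <= eps.
Proof.
move=> c0 eps0; near=> n.
have [C0|C0] := lerP C 0.
  by rewrite (le_trans _ (ltW eps0))// mulr_le0_ge0 ?expR_ge0.
rewrite -ler_pdivlMl// -[leRHS]lnK ?posrE ?mulr_gt0 ?invr_gt0// ler_expR lerNl.
rewrite -ler_pdivrMl// ltW//; near: n; exact: near_lt_lnn.
Unshelve. all: by end_near. Qed.

Lemma cvg0_expR_lnn (u : nat -> R) c C : 0 < c ->
  (\forall n \near \oo, `|u n| <= C * expR (- (c * ln n%:R))) ->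
  u @ \oo --> (0 : R).
Proof.
move=> c0 uC; apply/cvgr0Pnorm_le => eps eps0.
near=> n; apply: le_trans (_ : C * expR (- (c * ln n%:R)) <= _).
  by near: n.
by near: n; exact: near_expR_lnn_le.
Unshelve. all: by end_near. Qed.

Lemma half_sqr_lt_expR x : 0 <= x -> x ^+ 2 / 2 < expR x.
Proof.
move=> x0; have := @expR_ge1Dxn R x 1 x0.
by rewrite (_ : 2`!%N = 2)//; lra.
Qed.

Lemma near_alpha t : 0 < t -> \forall n \near \oo, 0 < alpha t n < 1.
Proof.
move=> t0; near=> n.
have n0 : (0 < n)%N by near: n; exact: nbhs_infty_gt.
have ln0 : 0 < ln n%:R :> R by near: n; exact: near_lt_lnn.
have ln2t : 2 * t < ln n%:R by near: n; exact: near_lt_lnn.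
rewrite /alpha divr_gt0 ?mulr_gt0 ?ltr0n//= ltr_pdivrMr ?ltr0n// mul1r.
rewrite -[ltRHS]expR_lnn//; apply: lt_trans (half_sqr_lt_expR (ltW ln0)).
by have : 2 * t * ln n%:R < ln n%:R * ln n%:R by [rewrite ltr_pM2r]; rewrite expr2; lra.
Unshelve. all: by end_near. Qed.

End Asymptotics.

(** * Polynomial rates and the threshold *)

Section Rates.
Variables (R : realType) (p1 p2 q t : R).
Hypotheses (hp1 : 0 < p1 < 1) (hp2 : 0 < p2 < 1) (hq : 0 < q < 1).
Hypotheses (p12 : p1 != p2) (ht : 0 < t).

Lemma split_err_rate : exists A B c : R, [/\ 0 < A, 0 < B, 0 < c &
  forall n, (1 < n)%N -> 0 < alpha t n < 1 ->
    avg (fun u : 'I_n => EE p1 p2 q (alpha t n)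
                     (fun sigma G => split_err p1 p2 q t sigma G u))
    <= A * expR (- (c * ln n%:R)) * genie_rate p1 p2 q t n
       + B * expR (- (2 * ln n%:R))].
Proof.
set g := gap p1 p2; have g0 : 0 < g by rewrite divr_gt0// normr_gt0 subr_eq0.
pose c0 := g ^+ 2 / 16 * t; have c00 : 0 < c0 by rewrite mulr_gt0// divr_gt0// exprn_gt0.
(* With L = Lam log n, [cE_many_revealed] gives exactly n^(-2). *)
pose Lam : R := (expR 1 - 1) * t + 2.
have e1 : 0 <= expR 1 - 1 :> R by rewrite subr_ge0 -[leLHS](@expR0 R) ler_expR.
have Lam0 : 0 < Lam by rewrite addr_gt0 ?mulr_gt0//; rewrite ltr_wpDl// mulr_ge0// ltW.
(* Each revealed mislabeled neighbour will cost n^(-c0 / 2), so K > 4 / c0 of them cost less than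
   n^(-2). *)
have [K hK] : exists K : nat, 4 / c0 < K%:R.
  by exists (Num.bound (4 / c0)); rewrite archi_boundP// divr_ge0 ?ltW.
(* Half of the decay n^(-c0) absorbs the log n in L, through y <= (2 / c0) e^(c0 y / 2). *)
pose C k : R := expR (2 * slope p1 p2 * k.+1%:R) * Lam * (2 / c0).
have C_gt0 k : 0 < C k by rewrite !mulr_gt0 ?expR_gt0 ?invr_gt0.
set d := (g / 4) ^+ 2 / 2.
have d0 : 0 < d by rewrite divr_gt0// exprn_gt0// divr_gt0.
set T := 1 + expR (2 * llr_bound p1 p2 q * K%:R).
have T0 : 0 < T by rewrite addr_gt0 ?expR_gt0.
exists (C 1%N * T), (C K ^+ K + 1 + 2 * (2 / d ^+ 2)), (c0 / 2); split.
- by rewrite mulr_gt0.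
- apply: addr_gt0; first by apply: addr_gt0 => //; exact: exprn_gt0.
  by rewrite mulr_gt0// divr_gt0// exprn_gt0.
- by rewrite divr_gt0.
move=> n n1 ha; have n0 : (0 < n)%N by exact: ltnW.
have ha' : 0 <= alpha t n <= 1 by have /andP[/ltW-> /ltW->] := ha.
set y := ln n%:R; have y0 : 0 <= y by rewrite ln_ge0// ler1n.
have ny : n%:R = expR y by rewrite expR_lnn.
pose L := Lam * y; have L0 : 0 <= L by rewrite mulr_ge0// ltW.
have rateL k : mislabel_rate p1 p2 t n k * L <= C k * expR (- (c0 / 2 * y)).
  have yle : y <= 2 / c0 * expR (c0 / 2 * y).
    rewrite -ler_pdivrMl ?divr_gt0// invf_div.
    by have := expR_ge1Dx (c0 / 2 * y); lra.
  rewrite /mislabel_rate /C /L -/y.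
  rewrite (_ : - (gap p1 p2 ^+ 2 / 16 * (t * y)) = - (c0 / 2 * y) - c0 / 2 * y); last first.
    by rewrite /c0 /g; field.
  rewrite expRD; set E := expR (- (c0 / 2 * y)).
  have EE1 : E * expR (c0 / 2 * y) = 1 by rewrite mulrC expRxMexpNx_1.
  rewrite [leLHS](_ : _ = expR (2 * slope p1 p2 * k.+1%:R) * Lam * E * (E * y)); last by ring.
  rewrite [leRHS](_ : _ = expR (2 * slope p1 p2 * k.+1%:R) * Lam * E * (2 / c0)); last by ring.
  rewrite ler_wpM2l ?mulr_ge0 ?expR_ge0 ?(ltW Lam0)//.
  by have := ler_wpM2l (expR_ge0 _ : 0 <= E) yle; rewrite mulrCA EE1 mulr1.
have rateL0 k : 0 <= mislabel_rate p1 p2 t n k * L.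
  by rewrite mulr_ge0// mislabel_rate_ge0.
have t1 : (mislabel_rate p1 p2 t n K * L) ^+ K <= C K ^+ K * expR (- (2 * y)).
  apply: (@le_trans _ _ ((C K * expR (- (c0 / 2 * y))) ^+ K)).
    apply: lerXn2r; rewrite ?nnegrE//.
    by apply: mulr_ge0; [exact: ltW|exact: expR_ge0].
  rewrite exprMn ler_wpM2l ?exprn_ge0 ?(ltW (C_gt0 _))// -expRM_natl ler_expR.
  rewrite mulrN lerN2 mulrA ler_wpM2r//.
  by move: hK; rewrite ltr_pdivrMr// => /ltW; lra.
have t2 : expR ((expR 1 - 1) * (t * ln n%:R) - L) = expR (- (2 * y)).
  by rewrite -/y /L /Lam; congr expR; ring.
have t3 : expR (- (d * n%:R)) <= 2 / d ^+ 2 * expR (- (2 * y)).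
  have dn0 : 0 <= d * n%:R by rewrite mulr_ge0// ltW.
  have := ltW (half_sqr_lt_expR dn0).
  rewrite exprMn {1}ny -expRM_natl !expRN => h.
  rewrite -[leRHS]invrK lef_pV2 ?posrE ?invr_gt0 ?expR_gt0//; last first.
    by rewrite mulr_gt0 ?invr_gt0 ?expR_gt0// divr_gt0// exprn_gt0.
  by rewrite invfM invrK invf_div mulrAC.
set gr := genie_rate _ _ _ _ _.
pose e (u : 'I_n) := EE p1 p2 q (alpha t n) (fun sigma G => (genie_err p1 p2 q u sigma G)%:R).
have e0 u : 0 <= e u by apply: EE_ge0.
set x := C 1%N * T * _; set b := (_ + _) * _.
rewrite [leRHS](_ : _ = avg (fun u => x * e u + b)); last first.
  rewrite /avg big_split mulrDr; congr (_ + _); last exact/esym/(avg_cst n1).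
  by rewrite /gr /genie_rate /avg mulrCA; congr (_ * _); rewrite mulr_sumr.
apply: le_avg => // u.
apply: le_trans (two_step_vs_genie hp1 hp2 hq n1 ha' u K L0) _.
apply: lerD.
  rewrite -/(e u) ler_wpM2r// /x -/T [leRHS]mulrAC.
  by apply: ler_wpM2r; [exact: ltW|exact: rateL].
rewrite t2 -/d /b; move: t1 (ler_wpM2l (ler0n R 2) t3).
by set v1 := (_ * L) ^+ K; set v2 := C K ^+ K; lra.
Qed.

Hypotheses (p1q : p1 != q) (p2q : p2 != q).

(** An almost minimising x is enough, because t > t_c is strict. The value at 1/2 is below 2, so the
    bracket inverted in [t_c] is positive. *)
Lemma t_c_chernoff : t_c p1 p2 q < t ->
  exists x : R, [/\ 0 <= x <= 1, Defs.chernoff p1 p2 q x <= 2 &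
    1 < (1 - 2^-1 * Defs.chernoff p1 p2 q x) * t].
Proof.
rewrite /t_c; set S := (X in inf X) => tc.
have ch0 x : 0 <= Defs.chernoff p1 p2 q x.
  by rewrite (chernoff_affinity _ _ _ true) addr_ge0 ?affinity_ge0.
have Sh : S (Defs.chernoff p1 p2 q 2^-1).
  by exists 2^-1 => //=; rewrite in_itv /=; lra.
have ch2 : Defs.chernoff p1 p2 q 2^-1 < 2.
  rewrite (chernoff_affinity _ _ _ false).
  have := affinity_half_lt1 hp1 hp2 hq false true p1q p2q.
  have := affinity_half_lt1 hp1 hp2 hq false false p1q p2q.
  lra.
have hasS : has_inf S.
  split; first by exists (Defs.chernoff p1 p2 q 2^-1).
  by exists 0 => _ [x _ <-].
have infS : inf S <= Defs.chernoff p1 p2 q 2^-1 by apply: ge_inf => //; case: hasS.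
have s0 : 0 < 1 - 2^-1 * inf S by lra.
have tS : 1 < (1 - 2^-1 * inf S) * t.
  by rewrite -ltr_pdivrMl// mulr1.
(* The slack is chosen so that inf S plus it equals 2 - 2 / t. *)
have eps0 : 0 < 2 * (1 - 2^-1 * inf S) - 2 / t.
  by rewrite subr_gt0 ltr_pdivrMr//; lra.
have [_ [x x01 <-] hx] := inf_adherent eps0 hasS.
have x01' : 0 <= x <= 1 by move: x01; rewrite /= in_itv.
have h : Defs.chernoff p1 p2 q x < 2 - 2 / t by lra.
have t20 : 0 < 2 / t by rewrite divr_gt0.
exists x; split => //; first lra.
have : 2 / t < 2 - Defs.chernoff p1 p2 q x by lra.
by rewrite ltr_pdivrMr//; lra.
Qed.

End Rates.

Theorem theorem2p5 (R : realType) (p1 p2 q t : R)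
    (hp1 : 0 < p1 < 1) (hp2 : 0 < p2 < 1) (hq : 0 < q < 1)
    (hp1p2 : p1 != p2) (hp1q : p1 != q) (hp2q : p2 != q) (ht : 0 < t) :
  let X_deg := fun (n : nat) (w : sample n) =>
    two_step p1 p2 q (obs w) (oriented p1 p2 (sigma_deg p1 p2 q t (obs w))) in
  (exists eps delta : nat -> R,
    [/\ eps @ \oo --> 0,
        (fun n => n%:R * delta n) @ \oo --> 0
      & forall n, Err p1 p2 q t (X_deg n)
          = (1 + eps n) * Err p1 p2 q t (@sigma_best R p1 p2 q t n) + delta n])
  /\ (t_c p1 p2 q < t -> exact_recovery p1 p2 q t X_deg).
Proof.
move=> X_deg.
have [A [B [c [A0 B0 c0 split_le]]]] := split_err_rate hp1 hp2 hq hp1p2 ht.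
have gr0 n : (1 < n)%N -> 0 < alpha t n < 1 -> 0 <= genie_rate p1 p2 q t n.
  move=> n1 /andP[/ltW a0 /ltW a1]; apply: avg_ge0 => // u.
  by apply: EE_ge0; rewrite ?a0.
split.
  have [kappa kappa0 aff] := affinity_gap hp1 hp2 hq hp1q hp2q.
  pose E n := Err p1 p2 q t (@sigma_best R p1 p2 q t n).
  pose dist n := Err p1 p2 q t (X_deg n) - E n.
  pose a n := 2 * A * expR (- (c * ln n%:R)).
  pose b n := B * expR (- (2 * ln n%:R)).
  have a0 n : 0 <= a n by rewrite !mulr_ge0 ?expR_ge0 ?(ltW A0).
  have b0 n : 0 < b n by rewrite mulr_gt0 ?expR_gt0.
  (* Once both error terms of [genie_rate_le] are at most 1/8, it yields [genie_rate] <= 2 E, which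
     turns the bound on the disagreements into one in terms of E. *)
  have dist_le : \forall n \near \oo, 0 <= E n /\ `|dist n| <= a n * E n + b n.
    near=> n.
    have n1 : (1 < n)%N by near: n; exact: nbhs_infty_gt.
    have ha : 0 < alpha t n < 1 by near: n; exact: near_alpha.
    have grE := genie_rate_le hp1 hp2 hq n1 ha (ltW kappa0) aff.
    have h1 : n%:R^-1 <= 8^-1 :> R.
      have -> : n%:R^-1 = 1 * expR (- (1 * ln n%:R)) :> R.
        by rewrite !mul1r expRN expR_lnn// ltnW.
      by near: n; apply: near_expR_lnn_le.
    have h2 : expR (llr_bound p1 p2 q + 2 * kappa)
        * expR (- (kappa * (t * ln n%:R))) <= 8^-1.
      rewrite [kappa * _]mulrA; near: n; apply: near_expR_lnn_le => //.
      exact: mulr_gt0.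
    have gr1 : genie_rate p1 p2 q t n <= 2 * E n.
      have := ler_wpM2r (gr0 n n1 ha) (lerD h1 h2).
      by move: grE; rewrite -/(E n); lra.
    have := gr0 n n1 ha; split; first by lra.
    apply: le_trans (Err_dist hp1 hp2 hq n1 ha) _.
    apply: le_trans (split_le n n1 ha) _; rewrite lerD2r /a.
    have := ler_wpM2l (mulr_ge0 (ltW A0) (expR_ge0 (- (c * ln n%:R)))) gr1.
    lra.
  (* The difference is shared in the proportion a E : b. This gives |eps| <= a and a remainder of
     size at most b, without dividing by E; the denominator is positive thanks to b. *)
  pose eps n := dist n * a n / (a n * E n + b n).
  exists eps, (fun n => dist n - eps n * E n); split.
  - apply: (@cvg0_expR_lnn _ _ c (2 * A)) => //; near=> n.
    have [E0 dE] : 0 <= E n /\ `|dist n| <= a n * E n + b n by near: n.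
    have s0 : 0 < a n * E n + b n by rewrite ltr_wpDl// mulr_ge0.
    rewrite /eps normrM normfV (gtr0_norm s0) ler_pdivrMr//.
    by rewrite normrM (ger0_norm (a0 n)) mulrC -/(a n) ler_wpM2l.
  - apply: (@cvg0_expR_lnn _ _ 1 B) => //; near=> n.
    have [E0 dE] : 0 <= E n /\ `|dist n| <= a n * E n + b n by near: n.
    have n0 : (0 < n)%N by near: n; exact: nbhs_infty_gt.
    have s0 : 0 < a n * E n + b n by rewrite ltr_wpDl// mulr_ge0.
    have -> : dist n - eps n * E n = dist n * b n / (a n * E n + b n).
      by rewrite /eps; field; rewrite gt_eqF.
    have nb : n%:R * b n = B * expR (- (1 * ln n%:R)).
      by rewrite /b -{1}(expR_lnn R n0) mulrCA -expRD; congr (_ * expR _); ring.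
    rewrite -nb normrM normr_nat ler_wpM2l// normrM normfV (gtr0_norm s0).
    rewrite ler_pdivrMr// normrM (gtr0_norm (b0 n)) mulrC ler_wpM2l//.
    exact: ltW.
  - by move=> n; rewrite -/(E n) /dist; ring.
move=> tc; have [x [x01 ch2 St]] := t_c_chernoff hp1 hp2 hq ht hp1q hp2q tc.
set S := 1 - _ * _ in St.
pose C := 2 * expR (llr_bound p1 p2 q + 1).
have C0 : 0 <= C by rewrite mulr_ge0 ?expR_ge0.
(* The union bound multiplies n^(-S t) and n^(-2) by n; m is the smaller of the two remaining
   exponents. *)
pose m := Num.min (S * t - 1) 1.
have m0 : 0 < m by rewrite lt_min; lra.
rewrite /exact_recovery.
suff : (fun n => 1 - recovery_Pr p1 p2 q t (X_deg n)) @ \oo --> (0 : R).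
  move=> /(cvgB (cvg_cst (1 : R))); rewrite subr0; apply: cvg_trans.
  by apply: near_eq_cvg; near=> n; rewrite /= subKr.
apply: (@cvg0_expR_lnn _ _ m ((1 + A) * C + B)) => //; near=> n.
have n1 : (1 < n)%N by near: n; exact: nbhs_infty_gt.
have ha : 0 < alpha t n < 1 by near: n; exact: near_alpha.
have ha' : 0 <= alpha t n <= 1 by have /andP[/ltW-> /ltW->] := ha.
set y := ln n%:R; have y0 : 0 <= y by rewrite ln_ge0// ler1n ltnW.
have ny : n%:R = expR y by rewrite expR_lnn// ltnW.
rewrite ger0_norm ?subr_ge0; last exact: recovery_Pr_le1.
apply: le_trans (recovery_failure hp1 hp2 hq n1 ha) _.
have gr_le : genie_rate p1 p2 q t n <= C * expR (- (S * t * y)).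
  rewrite -[leRHS](avg_cst n1); apply: le_avg => // u.
  by rewrite -mulrA; exact: genie_err_chernoff.
have sp := split_le n n1 ha; rewrite -/y in sp.
have ecy : expR (- (c * y)) <= 1.
  by rewrite -[leRHS](@expR0 R) ler_expR oppr_le0 mulr_ge0// ltW.
have gr_sp : genie_rate p1 p2 q t n + (avg (fun u : 'I_n => EE p1 p2 q (alpha t n)
      (fun sigma G => split_err p1 p2 q t sigma G u)))
    <= (1 + A) * (C * expR (- (S * t * y))) + B * expR (- (2 * y)).
  have : A * expR (- (c * y)) * genie_rate p1 p2 q t n
      <= A * (C * expR (- (S * t * y))).
    rewrite -mulrA ler_wpM2l ?(ltW A0)// -[leRHS]mul1r.
    by apply: ler_pM; rewrite ?expR_ge0 ?gr0.
  by move: gr_le sp; lra.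
apply: (@le_trans _ _ (n%:R * ((1 + A) * (C * expR (- (S * t * y)))
    + B * expR (- (2 * y))))); first by rewrite ler_wpM2l.
have k1 : n%:R * expR (- (S * t * y)) <= expR (- (m * y)).
  rewrite ny -expRD ler_expR; have : m <= S * t - 1 by rewrite ge_min lexx.
  by move/(ler_wpM2r y0); lra.
have k2 : n%:R * expR (- (2 * y)) <= expR (- (m * y)).
  rewrite ny -expRD ler_expR; have : m <= 1 by rewrite ge_min lexx orbT.
  by move/(ler_wpM2r y0); lra.
have AC0 : 0 <= (1 + A) * C by rewrite mulr_ge0// addr_ge0// ltW.
have := ler_wpM2l AC0 k1; have := ler_wpM2l (ltW B0) k2.
lra.
Unshelve. all: by end_near. Qed.
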